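(* Let $n\ge3$ be odd. Then the polarized variety $\bigl(T\backslash\!\backslash (G_{2,n})^{ss}_T(\mathcal{L}(n\omega_2)),\ \tilde{\mathcal{L}}(n\omega_2)\bigr)$ is projectively normal.
   Context: $T$ is the subgroup of diagonal matrices of $SL(n,\mathbb{C})$ and $G_{2,n}$ is the Grassmannian of $2$-dimensional subspaces of $\mathbb{C}^n$. $\mathcal{L}(\omega_2)$ is the pullback of $\mathcal{O}(1)$ under the Plücker embedding $G_{2,n}\hookrightarrow\mathbb{P}(\bigwedge^2\mathbb{C}^n)$ with its natural $T$-linearization, and $\mathcal{L}(n\omega_2)=\mathcal{L}(\omega_2)^{\otimes n}$. $(G_{2,n})^{ss}_T(\mathcal{L}(n\omega_2))$ is the set of points at which some $T$-invariant section of a positive power of $\mathcal{L}(n\omega_2)$ does not vanish, and the GIT quotient is $\mathrm{Proj}\bigoplus_{m\ge0}R(m)$ with $R(m)=H^0(G_{2,n},\mathcal{L}(n\omega_2)^{\otimes m})^T$. $\mathcal{L}(n\omega_2)$ descends to a line bundle $\tilde{\mathcal{L}}(n\omega_2)$ on the quotient, whose $m$-th power has space of global sections $R(m)$. A polarized variety $(Y,\mathcal{M})$ is projectively normal if the ring $\bigoplus_{m\ge0}H^0(Y,\mathcal{M}^{\otimes m})$ is normal and generated in degree $1$ over $\mathbb{C}$. *)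

(* Defs.v *)
From HB Require Import structures.
From mathcomp Require Import all_boot all_order all_algebra.
From mathcomp Require Import mpoly complex.
From mathcomp Require Import boolp classical_sets functions reals.

Set Implicit Arguments.
Unset Strict Implicit.
Unset Printing Implicit Defensive.

Import Order.TTheory GRing.Theory Num.Theory.
Local Open Scope classical_set_scope.
Local Open Scope ring_scope.

(* Throughout, the complex numbers are R[i] for R : realType.                 *)
(* A line bundle on a projective variety is represented by its global         *)
(* sections, seen as functions on the punctured affine cone over the variety  *)
(* (the complement of the zero section in the dual of the line bundle).       *)

(* Integrally closed domains. Rings of functions on a possibly empty set are  *)
(* only comPzRingType in the library, hence the explicit 1 <> 0 and the monic *)
(* equation written out instead of integralOver. K ranges over the fields of  *)
(* fractions of A.                                                            *)
Definition normal_domain (A : comPzRingType) : Prop :=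
  [/\ (1 : A) <> 0,
      forall a b : A, a * b = 0 -> a = 0 \/ b = 0 &
      forall (K : fieldType) (phi : {rmorphism A -> K}),
        injective phi ->
        (forall x : K, exists a b : A, b <> 0 /\ x = phi a / phi b) ->
        forall (x : K) (N : nat) (c : 'I_N -> A),
          x ^+ N + \sum_(i < N) phi (c i) * x ^+ i = 0 ->
          exists a : A, x = phi a].

Section GradedAlgebras.
Variable R : realType.
Local Notation C := R[i].

(* Graded algebras of complex functions. By piece_free the sum of the pieces  *)
(* inside the ring of all functions is a direct sum.                          *)
Record gradedAlg (X : Type) := GradedAlg {
  piece :> nat -> set (X -> C);
  piece_cst : forall c : C, piece 0%N (cst c);
  piece_zero : forall m, piece m 0;
  pieceB : forall m f g, piece m f -> piece m g -> piece m (f - g);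
  pieceM : forall m k f g, piece m f -> piece k g -> piece (m + k)%N (f * g);
  piece_free : forall N (s : nat -> X -> C), (forall m, piece m (s m)) ->
    \sum_(m < N) s m = 0 -> forall m, (m < N)%N -> s m = 0
}.

Section DirectSum.
Variables (X : Type) (A : gradedAlg X).

Definition direct_sum : {pred X -> C} := fun f =>
  `[< exists N (s : nat -> X -> C),
        (forall m, A m (s m)) /\ f = \sum_(m < N) s m >].

Lemma pieceN m f : A m f -> A m (- f).
Proof. by move=> Af; rewrite -sub0r; apply: pieceB => //; exact: piece_zero. Qed.

Lemma pieceD m f g : A m f -> A m g -> A m (f + g).
Proof. by move=> Af Ag; rewrite -[g]opprK; apply: pieceB => //; exact: pieceN. Qed.

Lemma piece_sum m (I : Type) (r : seq I) (P : pred I) (F : I -> X -> C) :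
  (forall i, P i -> A m (F i)) -> A m (\sum_(i <- r | P i) F i).
Proof. by move=> AF; elim/big_ind: _ => //; [exact: piece_zero|exact: pieceD]. Qed.

Lemma direct_sum_widen N M (s : nat -> X -> C) : (N <= M)%N ->
  \sum_(m < N) s m = \sum_(m < M) (if (m < N)%N then s m else 0).
Proof.
by move=> NM; rewrite (big_ord_widen M s NM) big_mkcond.
Qed.

Lemma direct_sum_subring_closed : subring_closed direct_sum.
Proof.
split.
- apply/asboolP; exists 1%N, (fun m => if m == 0%N then 1 else 0); split.
    by case=> [|m] /=; [exact: piece_cst|exact: piece_zero].
  by rewrite big_ord1.
- move=> f g /asboolP[N [s [As ->]]] /asboolP[M [t [At ->]]].
  apply/asboolP; exists (maxn N M), (fun m =>
    (if (m < N)%N then s m else 0) - (if (m < M)%N then t m else 0)); split.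
    by move=> m; apply: pieceB; case: ifP => // _; exact: piece_zero.
  by rewrite sumrB -!direct_sum_widen ?leq_maxl ?leq_maxr.
- move=> f g /asboolP[N [s [As ->]]] /asboolP[M [t [At ->]]].
  apply/asboolP; exists (N + M)%N, (fun k =>
    \sum_(i < N) \sum_(j < M | (i + j == k)%N) s i * t j); split.
    move=> k; apply: piece_sum => i _; apply: piece_sum => j /eqP <-.
    exact: pieceM.
  rewrite mulr_suml exchange_big /=; apply: eq_bigr => i _.
  rewrite mulr_sumr; under [RHS]eq_bigr do rewrite big_mkcond /=.
  rewrite exchange_big /=; apply: eq_bigr => j _.
  have ltij : (i + j < N + M)%N.
    by rewrite -addnS leq_add // ltnW.
  rewrite (bigD1 (Ordinal ltij)) //= eqxx big1 ?addr0 // => k.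
  by rewrite -val_eqE /= eq_sym => /negPf ->.
Qed.

HB.instance Definition _ :=
  GRing.isSubringClosed.Build (X -> C) direct_sum direct_sum_subring_closed.

Record gradedRing :=
  GradedRing { gradedRing_val : X -> C; _ : gradedRing_val \in direct_sum }.
HB.instance Definition _ := [isSub for gradedRing_val].
HB.instance Definition _ := [Choice of gradedRing by <:].
HB.instance Definition _ :=
  GRing.SubChoice_isSubComPzRing.Build (X -> C) direct_sum gradedRing
    direct_sum_subring_closed.

Definition generated_in_degree_one : Prop :=
  forall B : set (X -> C),
    (forall c : C, B (cst c)) ->
    (forall f g, B f -> B g -> B (f - g)) ->
    (forall f g, B f -> B g -> B (f * g)) ->
    A 1%N `<=` B ->
    forall f, f \in direct_sum -> B f.

Definition projectively_normal : Prop :=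
  normal_domain gradedRing /\ generated_in_degree_one.

(* When A is the algebra of invariant sections, this is the semistable locus. *)
Definition nonvanishing_locus : set X :=
  [set x | exists m f, [/\ (0 < m)%N, A m f & f x != 0]].

(* Global sections of O(m) on Proj A. The points of Proj A are the images of  *)
(* those of nonvanishing_locus, and locally a section is a quotient a / b of  *)
(* homogeneous elements of A with deg a - deg b = m.                          *)
Definition Proj_section (m : nat) : set (nonvanishing_locus -> C) :=
  [set g | forall x : nonvanishing_locus, exists k (a b : X -> C),
     [/\ A (m + k)%N a, A k b, b (val x) != 0 &
         forall y : nonvanishing_locus, b (val y) != 0 ->
           g y = a (val y) / b (val y)]].

Lemma Proj_section_cst c : Proj_section 0 (cst c).
Proof.
move=> x; exists 0%N, (cst c), (cst 1).
by split; rewrite ?oner_eq0 ?divr1 //; try exact: piece_cst; move=> y _; rewrite divr1.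
Qed.

Lemma Proj_section_zero m : Proj_section m 0.
Proof.
move=> x; exists 0%N, 0, (cst 1).
split; rewrite ?oner_eq0 //; [exact: piece_zero|exact: piece_cst|].
by move=> y _; rewrite mul0r.
Qed.

Lemma Proj_sectionB m f g :
  Proj_section m f -> Proj_section m g -> Proj_section m (f - g).
Proof.
move=> Pf Pg x; have [k [a [b [Aa Ab bx fE]]]] := Pf x.
have [l [c [d [Ac Ad dx gE]]]] := Pg x.
exists (k + l)%N, (a * d - c * b), (b * d); split.
- apply: pieceB; first by rewrite addnA; exact: pieceM.
  by rewrite [(k + l)%N]addnC addnA; exact: pieceM.
- exact: pieceM.
- by rewrite /= mulf_neq0.
- move=> y; rewrite mulf_eq0 negb_or => /andP[by0 dy0].
  have -> : (f - g) y = f y - g y by [].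
  rewrite (fE y by0) (gE y dy0) -mulNr addf_div //.
  by congr (_ / _); rewrite mulNr.
Qed.

Lemma Proj_sectionM m l f g :
  Proj_section m f -> Proj_section l g -> Proj_section (m + l) (f * g).
Proof.
move=> Pf Pg x; have [k [a [b [Aa Ab bx fE]]]] := Pf x.
have [j [c [d [Ac Ad dx gE]]]] := Pg x.
exists (k + j)%N, (a * c), (b * d); split.
- by rewrite addnACA; exact: pieceM.
- exact: pieceM.
- by rewrite /= mulf_neq0.
- move=> y; rewrite mulf_eq0 negb_or => /andP[by0 dy0].
  have -> : (f * g) y = f y * g y by [].
  by rewrite (fE y by0) (gE y dy0) mulf_div.
Qed.

Lemma Proj_section_common N (s : nat -> nonvanishing_locus -> C)
    (x : nonvanishing_locus) : (forall m, Proj_section m (s m)) ->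
  exists k (a : nat -> X -> C) (b : X -> C), [/\ (0 < k)%N, A k b, b (val x) != 0 &
    forall m, (m < N)%N -> A (m + k)%N (a m) /\
      forall y : nonvanishing_locus, b (val y) != 0 ->
        s m y = a m (val y) / b (val y)].
Proof.
move=> Ps; elim: N => [|N [k [a [b [k0 Ab bx IH]]]]].
  have [m [f [m0 Af fx]]] := set_valP x.
  by exists m, (fun=> 0), f; split.
have [l [c [d [Ac Ad dx sE]]]] := Ps N x.
exists (k + l)%N, (fun m => if m == N then c * b else a m * d), (b * d).
split; [by rewrite ltn_addr|exact: pieceM|by rewrite /= mulf_neq0|].
move=> m; rewrite ltnS leq_eqVlt; have [-> _|mN /= /IH[Aa aE]] := eqVneq m N.
  split; first by rewrite [(k + l)%N]addnC addnA; exact: pieceM.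
  move=> y; rewrite mulf_eq0 negb_or => /andP[by0 dy0].
  rewrite (sE y dy0) -[RHS]/(c (val y) * b (val y) / (b (val y) * d (val y))).
  by rewrite [b (val y) * d _]mulrC -mulf_div divff ?mulr1.
split; first by rewrite addnA; exact: pieceM.
move=> y; rewrite mulf_eq0 negb_or => /andP[by0 dy0].
rewrite (aE y by0).
rewrite -[RHS]/(a m (val y) * d (val y) / (b (val y) * d (val y))).
by rewrite -mulf_div divff ?mulr1.
Qed.

Lemma Proj_section_free N (s : nat -> nonvanishing_locus -> C) :
  (forall m, Proj_section m (s m)) -> \sum_(m < N) s m = 0 ->
  forall m, (m < N)%N -> s m = 0.
Proof.
move=> Ps s0 m mN; apply/funext => x.
have [k [a [b [k0 Ab bx aE]]]] := Proj_section_common N x Ps.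
pose t j := if (k + k <= j)%N && (j < k + k + N)%N
            then a (j - (k + k))%N * b else 0.
have At j : A j (t j).
  rewrite /t; case: ifP => [/andP[kj jN]|_]; last exact: piece_zero.
  have jN' : (j - (k + k) < N)%N by rewrite ltn_subLR.
  have [Aa _] := aE _ jN'.
  by have := pieceM Aa Ab; rewrite -addnA subnK.
have t0 : \sum_(j < k + k + N) t j = 0.
  rewrite big_split_ord /= big1 ?add0r => [|i _]; last first.
    by rewrite /t leqNgt ltn_ord.
  under eq_bigr => i _ do rewrite /t leq_addr ltn_add2l ltn_ord /= addKn.
  apply/funext => y; rewrite fct_sumE.
  have [b0|b0] := eqVneq (b y) 0.
    by rewrite big1 // => i _; rewrite /= -[RHS](mulr0 (a i y)) -b0.
  have yss : y \in nonvanishing_locus by rewrite inE; exists k, b.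
  pose z : nonvanishing_locus := SigSub yss.
  have sz : \sum_(i < N) s i z = 0.
    by have := congr1 (fun h => h z) s0; rewrite /= fct_sumE.
  suff -> : \sum_(i < N) (a i * b) y = (\sum_(i < N) s i z) * (b y * b y).
    by rewrite sz mul0r.
  rewrite mulr_suml.
  apply: eq_bigr => i _; have [_ ->//] := aE i (ltn_ord i).
  by rewrite -[LHS]/(a i y * b y) /= mulrA divfK.
have := piece_free At t0 (m := (k + k + m)%N); rewrite ltn_add2l mN => /(_ isT).
rewrite /t leq_addr ltn_add2l mN /= addKn => /(congr1 (fun h => h (val x))) /=.
move=> /eqP; rewrite mulf_eq0 (negPf bx) orbF => /eqP ax.
by have [_ ->//] := aE m mN; rewrite ax mul0r.
Qed.

Definition Proj_sections : gradedAlg nonvanishing_locus :=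
  GradedAlg Proj_section_cst Proj_section_zero Proj_sectionB Proj_sectionM
    Proj_section_free.

End DirectSum.
End GradedAlgebras.

Section Grassmannian.
Variables (R : realType) (n : nat).
Local Notation C := R[i].

(* The second exterior power of C^n is the space of alternating matrices, and *)
(* the (i, j) entry of u /\ v is the Pluecker coordinate p_ij.                *)
Definition wedge (u v : 'rV[C]_n) : 'M[C]_n := u^T *m v - v^T *m u.

(* The punctured affine cone over G_{2,n} in its Pluecker embedding.          *)
Definition grass_cone : set 'M[C]_n :=
  [set w | w != 0 /\ exists W : {vspace 'rV[C]_n},
     \dim W = 2%N /\ exists u v, [/\ u \in W, v \in W & w = wedge u v]].

Definition meval_mx (p : {mpoly C[n * n]}) (w : 'M[C]_n) : C := p.@[mxvec w 0].

(* H^0(G_{2,n}, L(omega_2)^d), with L(omega_2) the pullback of O(1): locally, *)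
(* on a basic Zariski open set, a section is a quotient of forms with degree  *)
(* difference d.                                                              *)
Definition grass_section (d : nat) : set (grass_cone -> C) :=
  [set f | forall x : grass_cone, exists k (P Q : {mpoly C[n * n]}),
     [/\ P \is (d + k)%N.-homog, Q \is k.-homog, meval_mx Q (val x) != 0 &
         forall y : grass_cone, meval_mx Q (val y) != 0 ->
           f y = meval_mx P (val y) / meval_mx Q (val y)]].

Definition torus : set 'M[C]_n := [set t | is_diag_mx t /\ \det t = 1].

(* t in T maps u /\ v to (u t) /\ (v t), i.e. w to t^T w t.                   *)
Definition torus_invariant (f : grass_cone -> C) : Prop :=
  forall t, torus t -> forall x y : grass_cone,
    val y = t^T *m val x *m t -> f y = f x.

(* R(m) = H^0(G_{2,n}, L(n omega_2)^m)^T                                      *)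
Definition invariant_section (m : nat) : set (grass_cone -> C) :=
  [set f | grass_section (n * m) f /\ torus_invariant f].

Lemma wedgeZl c u v : wedge (c *: u) v = c *: wedge u v.
Proof. by rewrite /wedge linearZ /= -scalemxAl -scalemxAr scalerBr. Qed.

Lemma grass_coneZ c w : c != 0 -> grass_cone w -> grass_cone (c *: w).
Proof.
move=> c0 [w0 [W [W2 [u [v [uW vW wE]]]]]].
split; first by rewrite scaler_eq0 negb_or c0.
exists W; split=> //; exists (c *: u), v; split=> //.
  exact: memvZ.
by rewrite wedgeZl wE.
Qed.

Lemma meval_mxZ p d c w : p \is d.-homog ->
  meval_mx p (c *: w) = c ^+ d * meval_mx p w.
Proof.
move=> /dhomogP hp; rewrite /meval_mx !mevalE mulr_sumr big_seq [RHS]big_seq.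
apply: eq_bigr => m /hp /= md.
rewrite mulrCA; congr (_ * _); rewrite linearZ /=.
under eq_bigr do rewrite mxE exprMn.
by rewrite big_split /= prodrXr -mdegE md.
Qed.

Lemma grass_sectionZ d f c (x y : grass_cone) : grass_section d f ->
  c != 0 -> val y = c *: val x -> f y = c ^+ d * f x.
Proof.
move=> df c0 yx; have [k [P [Q [hP hQ Qx fE]]]] := df x.
have Qy : meval_mx Q (val y) != 0.
  by rewrite yx (meval_mxZ c _ hQ) mulf_neq0 ?expf_neq0.
rewrite (fE y Qy) (fE x Qx) yx (meval_mxZ c _ hQ) (meval_mxZ c _ hP).
rewrite exprD -!mulrA; congr (_ * _); rewrite mulrA -mulf_div.
by rewrite divff ?mul1r ?expf_neq0.
Qed.

Lemma invariant_section_cst c : invariant_section 0 (cst c).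
Proof.
split=> // x; exists 0%N, c%:MP, 1; rewrite muln0 addn0.
split; [|exact: dhomog1| |].
- by rewrite -[c%:MP]mulr1 mul_mpolyC; apply: dhomogZ; exact: dhomog1.
- by rewrite /meval_mx meval1 oner_eq0.
- by move=> y _; rewrite /meval_mx mevalC meval1 divr1.
Qed.

Lemma invariant_section_zero m : invariant_section m 0.
Proof.
split=> // x; exists 0%N, 0, 1.
split; [exact: dhomog0|exact: dhomog1| |].
- by rewrite /meval_mx meval1 oner_eq0.
- by move=> y _; rewrite /meval_mx meval0 mul0r.
Qed.

Lemma invariant_sectionB m f g : invariant_section m f ->
  invariant_section m g -> invariant_section m (f - g).
Proof.
move=> [df Tf] [dg Tg]; split; last first.
  move=> t Tt x y xy; rewrite -[LHS]/(f y - g y) -[RHS]/(f x - g x).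
  by rewrite (Tf t Tt x y xy) (Tg t Tt x y xy).
move=> x; have [k [P [Q [hP hQ Qx fE]]]] := df x.
have [l [P' [Q' [hP' hQ' Qx' gE]]]] := dg x.
exists (k + l)%N, (P * Q' - P' * Q), (Q * Q'); split.
- apply: rpredB; first by rewrite addnA; exact: dhomogM.
  by rewrite [(k + l)%N]addnC addnA; exact: dhomogM.
- exact: dhomogM.
- by rewrite /meval_mx mevalM mulf_neq0.
- move=> y; rewrite /meval_mx mevalB !mevalM mulf_eq0 negb_or.
  move=> /andP[Qy Qy']; rewrite -[LHS]/(f y - g y) (fE y Qy) (gE y Qy').
  by rewrite -mulNr addf_div // mulNr.
Qed.

Lemma invariant_sectionM m l f g : invariant_section m f ->
  invariant_section l g -> invariant_section (m + l) (f * g).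
Proof.
move=> [df Tf] [dg Tg]; split; last first.
  move=> t Tt x y xy; rewrite -[LHS]/(f y * g y) -[RHS]/(f x * g x).
  by rewrite (Tf t Tt x y xy) (Tg t Tt x y xy).
move=> x; have [k [P [Q [hP hQ Qx fE]]]] := df x.
have [j [P' [Q' [hP' hQ' Qx' gE]]]] := dg x.
exists (k + j)%N, (P * P'), (Q * Q'); split.
- by rewrite mulnDr addnACA; exact: dhomogM.
- exact: dhomogM.
- by rewrite /meval_mx mevalM mulf_neq0.
- move=> y; rewrite /meval_mx !mevalM mulf_eq0 negb_or.
  move=> /andP[Qy Qy']; rewrite -[LHS]/(f y * g y) (fE y Qy) (gE y Qy').
  by rewrite mulf_div.
Qed.

Lemma invariant_section_free N (s : nat -> grass_cone -> C) :
  (forall m, invariant_section m (s m)) -> \sum_(m < N) s m = 0 ->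
  forall m, (m < N)%N -> s m = 0.
Proof.
move=> Is s0 m mN; apply/funext => x.
have [n0|n_gt0] := posnP n.
  have [+ _] := set_valP x; case/eqP; apply/matrixP => i.
  by have := ltn_ord i; rewrite [X in (_ < X)%N]n0.
pose p : {poly C} := \sum_(j < N) (s j x)%:P * 'X^(n * j).
have pE c : c != 0 -> p.[c] = 0.
  move=> c0; have cx : c *: val x \in grass_cone.
    by rewrite inE; apply: grass_coneZ => //; exact: set_valP.
  suff -> : p.[c] = (\sum_(j < N) s j) (SigSub cx) by rewrite s0.
  rewrite fct_sumE horner_sum; apply: eq_bigr => i _.
  rewrite hornerM hornerC hornerXn mulrC.
  by rewrite (grass_sectionZ (x := x) (y := SigSub cx) (Is i).1 c0).
have p0 : p = 0.
  apply/eqP; apply: contraT => pn0.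
  pose r := [seq (i.+1)%:R : C | i <- iota 0 (size p)].
  have := max_poly_roots pn0 (rs := r).
  rewrite size_map size_iota ltnn; apply.
    by apply/allP => _ /mapP[i _ ->]; rewrite rootE pE ?pnatr_eq0.
  by rewrite map_inj_uniq ?iota_uniq // => i j /mulrIn; rewrite oner_eq0 => /(_ isT) [].
have := congr1 (fun q : {poly C} => q`_(n * m)) p0.
rewrite /= coef0 coef_sum (bigD1 (Ordinal mN)) //= big1 ?addr0 => [|i im].
  by rewrite coefCM coefXn eqxx mulr1.
rewrite coefCM coefXn eqn_pmul2l // -[m]/(val (Ordinal mN)) val_eqE eq_sym.
by rewrite (negPf im) mulr0.
Qed.

Definition invariant_sections : gradedAlg R grass_cone :=
  GradedAlg invariant_section_cst invariant_section_zero invariant_sectionB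
    invariant_sectionM invariant_section_free.

(* The quotient is Proj of the algebra of invariant sections, and the bundle  *)
(* descended from L(n omega_2) is its O(1).                                   *)
Definition git_quotient_sections :
    gradedAlg R (nonvanishing_locus invariant_sections) :=
  Proj_sections invariant_sections.

End Grassmannian.

(* Main.v *)
Require Import Defs.
From HB Require Import structures.
From mathcomp Require Import boolp classical_sets functions reals.
From mathcomp Require Import all_boot all_order all_algebra all_fingroup.
From mathcomp Require Import mpoly complex ring zify.

Set Implicit Arguments.
Unset Strict Implicit.
Unset Printing Implicit Defensive.
Import Order.TTheory GRing.Theory Num.Theory.
Local Open Scope ring_scope.

(** A point of the punctured cone is u /\ v for two vectors u, v of C^n, that is
    for a 2 x n matrix, and its coordinates are the minors p_ij. Functions on
    the cone and on its semistable locus are replaced by polynomials in the 2n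
    entries of the matrix.

    Sections are polynomials. A function on an open set U that is locally a
    quotient of polynomials is the restriction of a polynomial as soon as U
    contains all lines parallel to the axes through a general point ([hartogs]).
    For sections of O(d) on the cone, n >= 3, this holds because moving one
    column leaves a nonzero minor among the others. For sections of O(m) on the
    quotient it holds when n >= 4: if the columns are in general position and
    one entry of column i moves, then column i stays nonzero, so it becomes
    parallel to at most one column j, and a cyclic rotation f of the columns
    that never pairs i with j gives a nonvanishing invariant section, the
    product of the p_(k, f k). For n = 3 the invariants of degree m are the
    multiples of (p_01 p_12 p_20)^m, and a section is read off at one point.

    Invariants. The polynomials obtained are invariant under SL_2 and under T.
    Invariance under T makes all column degrees of a monomial equal, to c say,
    and invariance under SL_2 makes its degrees in u and in v equal, so that n c
    is even; as n is odd, c = 2m. By the first fundamental theorem for SL_2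
    ([fft], from Capelli's identity) the invariant is then a combination of
    products of p_ij over the edges of multigraphs on the columns in which
    every degree is 2m. By Petersen's theorem ([petersen]) such a multigraph
    is a union of m permutation graphs, hence the product is, up to sign, a
    product of m invariant sections of degree 1. This is generation in
    degree 1, and it also shows that every invariant polynomial comes from a
    sum of sections.

    Normality. The ring of sections is thereby the ring of invariant
    polynomials, which is a domain. If a / b is integral over it, then b
    divides a among all polynomials ([mdvd_integral]), and the quotient of two
    invariants is invariant.

    Both [hartogs] and [mdvd_integral] assert that one polynomial divides
    another. This is tested on lines parallel to the axes ([mdvd_lines]), where
    it becomes a matter of polynomials in one variable. *)

(** * Polynomials as functions *)

Section PolynomialFunctions.
Variable F : numClosedFieldType.

Lemma mpoly_gen_ind N (P : {mpoly F[N]} -> Prop) :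
  (forall c, P c%:MP) -> (forall i, P 'X_i) ->
  (forall p q, P p -> P q -> P (p + q)) ->
  (forall p q, P p -> P q -> P (p * q)) -> forall p, P p.
Proof.
move=> PC PX PD PM p; rewrite [p]mpolyE; elim/big_ind: _ => //.
  by rewrite -(mpolyC0 N); exact: PC.
move=> m _; rewrite -mul_mpolyC; apply: (PM) => //; rewrite mpolyXE_id.
elim/big_ind: _ => //; first by rewrite -(mpolyC1 N); exact: PC.
move=> i _; elim: (m i) => [|k IH]; first by rewrite expr0 -(mpolyC1 N); exact: PC.
by rewrite exprS; apply: PM.
Qed.

Lemma poly_fun_eq0 (p : {poly F}) : (forall t, p.[t] = 0) -> p = 0.
Proof.
move=> p0; apply/eqP; apply: contraT => pn0.
have := max_poly_roots pn0 (rs := [seq (i%:R : F) | i <- iota 0 (size p)]).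
rewrite size_map size_iota ltnn; apply.
  by apply/allP => _ /mapP[i _ ->]; rewrite rootE p0.
by rewrite map_inj_uniq ?iota_uniq //; exact: mulrIn (oner_neq0 _).
Qed.

Lemma poly_fun_eq (p q : {poly F}) : (forall t, p.[t] = q.[t]) -> p = q.
Proof.
move=> pq; apply/eqP; rewrite -subr_eq0; apply/eqP/poly_fun_eq0 => t.
by rewrite hornerD hornerN pq subrr.
Qed.

(** * Splitting off the last variable *)

(** The case analysis is the one in the definition of [muni]. *)
Definition extend N (x : 'I_N -> F) (t : F) (j : 'I_N.+1) : F :=
  match split (cast_ord (esym (addn1 N)) j) with inl i => x i | inr _ => t end.

Definition at_point N (x : 'I_N -> F) (p : {poly {mpoly F[N]}}) : {poly F} :=
  map_poly (meval x) p.

Lemma at_pointD N (x : 'I_N -> F) : {morph at_point x : p q / p + q}.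
Proof. exact: (rmorphD (map_poly (meval x))). Qed.

Lemma at_pointM N (x : 'I_N -> F) : {morph at_point x : p q / p * q}.
Proof. exact: (rmorphM (map_poly (meval x))). Qed.

Lemma at_pointC N (x : 'I_N -> F) c : at_point x c%:P = (c.@[x])%:P.
Proof. exact: map_polyC. Qed.

Lemma at_pointX N (x : 'I_N -> F) : at_point x 'X = 'X.
Proof. exact: map_polyX. Qed.

Lemma coef_at_point N (x : 'I_N -> F) p k : (at_point x p)`_k = (p`_k).@[x].
Proof. exact: coef_map. Qed.

Lemma muni_horner N (P : {mpoly F[N.+1]}) x t :
  (at_point x (muni P)).[t] = P.@[extend x t].
Proof.
elim/mpoly_gen_ind: P => [c|i|p q hp hq|p q hp hq].
- by rewrite muniC at_pointC hornerC !mevalC.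
- rewrite mevalXU /muni mmapX mmap1U /extend; case: split => j.
    by rewrite at_pointC hornerC mevalXU.
  by rewrite at_pointX hornerX.
- by rewrite muniD at_pointD hornerD mevalD; congr (_ + _).
- by rewrite muniM at_pointM hornerM mevalM; congr (_ * _).
Qed.

Definition unmuni N (p : {poly {mpoly F[N]}}) : {mpoly F[N.+1]} :=
  (map_poly (@mwiden N F) p).['X_ord_max].

Lemma unmuniD N : {morph @unmuni N : p q / p + q}.
Proof.
move=> p q; rewrite /unmuni (rmorphD (map_poly (@mwiden N F))).
exact: hornerD.
Qed.

Lemma unmuniM N : {morph @unmuni N : p q / p * q}.
Proof.
move=> p q; rewrite /unmuni (rmorphM (map_poly (@mwiden N F))).
exact: hornerM.
Qed.

Lemma unmuniC N c : @unmuni N c%:P = mwiden c.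
Proof. by rewrite /unmuni map_polyC hornerC. Qed.

Lemma unmuni0 N : @unmuni N 0 = 0.
Proof. by rewrite -polyC0 unmuniC mwiden0. Qed.

Lemma unmuniX N : @unmuni N 'X = 'X_ord_max.
Proof. by rewrite /unmuni map_polyX hornerX. Qed.

Lemma muniK N : cancel (@muni N F) (@unmuni N).
Proof.
elim/mpoly_gen_ind => [c|i|p q hp hq|p q hp hq].
- by rewrite muniC unmuniC mwidenC.
- rewrite /muni mmapX mmap1U; case: splitP => [j /= ij|k /= ik].
    rewrite unmuniC mwidenX mnmwiden1.
    by congr 'X_ _; apply/val_inj.
  rewrite unmuniX; congr 'X_ _; apply/val_inj => /=.
  by move: ik; rewrite ord1 addn0 => ->.
- by rewrite muniD unmuniD; congr (_ + _).
- by rewrite muniM unmuniM; congr (_ * _).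
Qed.

Lemma meval_fun_eq0 N (P : {mpoly F[N]}) : (forall x, P.@[x] = 0) -> P = 0.
Proof.
elim: N P => [|N IH] P P0.
  by have := P0 (fun=> 0); rewrite [P]nvar0_mpolyC mevalC => ->.
rewrite -[P]muniK -[RHS]muniK muni0; congr unmuni; apply/polyP => k.
rewrite coef0; apply: IH => x.
have /polyP/(_ k) : at_point x (muni P) = 0.
  by apply: poly_fun_eq0 => t; rewrite muni_horner P0.
by rewrite coef_at_point coef0.
Qed.

Lemma meval_neq0 N (P : {mpoly F[N]}) : P != 0 -> exists x, P.@[x] != 0.
Proof.
move=> P0; apply: contrapT => /forallNP P0'; case/eqP: P0.
by apply: meval_fun_eq0 => x; apply: contrapT => /eqP; exact: P0'.
Qed.

Lemma meval_dense N (H P Q : {mpoly F[N]}) : H != 0 ->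
  (forall x, H.@[x] != 0 -> P.@[x] = Q.@[x]) -> P = Q.
Proof.
move=> H0 PQ; apply/eqP; rewrite -subr_eq0; apply: contraT => PQ0.
have [x] := meval_neq0 (mulf_neq0 H0 PQ0).
by rewrite mevalM mevalB mulf_eq0 negb_or subr_eq0 => /andP[/PQ ->]; rewrite eqxx.
Qed.

(** * Divisibility can be tested one variable at a time *)

(** Stated on values, so that it passes at once to leading coefficients. *)
Definition indep N (i : 'I_N) (r : {mpoly F[N]}) :=
  forall x y, (forall j, j != i -> x j = y j) -> r.@[x] = r.@[y].

Lemma indep_coef_muni N (i : 'I_N) (r : {mpoly F[N.+1]}) k :
  indep (widen_ord (leqnSn N) i) r -> indep i (muni r)`_k.
Proof.
move=> ri x y xy; have : at_point x (muni r) = at_point y (muni r).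
  apply: poly_fun_eq => t; rewrite !muni_horner; apply: ri => j ji.
  rewrite /extend; case: splitP => [l /= jl|//]; apply: xy.
  by apply: contraNneq ji => <-; apply/eqP/val_inj.
by move=> /polyP/(_ k); rewrite !coef_at_point.
Qed.

Lemma indep_last_muni N (r : {mpoly F[N.+1]}) :
  indep ord_max r -> exists c : {mpoly F[N]}, muni r = c%:P.
Proof.
move=> ri; exists (muni r)`_0; apply/polyP => k; rewrite coefC.
case: eqP => [->//|/eqP k0]; apply: meval_fun_eq0 => x.
have /polyP/(_ k) : at_point x (muni r) = ((at_point x (muni r)).[0])%:P.
  apply: poly_fun_eq => t; rewrite hornerC !muni_horner; apply: ri => j jm.
  rewrite /extend; case: splitP => [//|l /= jl]; case/eqP: jm.
  by apply/val_inj; rewrite /= jl ord1 addn0.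
by rewrite coef_at_point coefC (negPf k0).
Qed.

Definition mdvd N (q p : {mpoly F[N]}) := exists s : {mpoly F[N]}, p = q * s.

(** The induction step of [mdvd_indep] below, for a fraction h / c whose
    denominator is free of the last variable. Comparing leading coefficients in
    r * h = c * T, the leading coefficient of h satisfies the hypothesis in one
    variable less, so c divides it, and the leading term of h can be removed. *)
Lemma mdvd_coefs N (c : {mpoly F[N]}) (h : {poly {mpoly F[N]}}) :
  (forall a : {mpoly F[N]},
     (forall i : 'I_N, exists r : {mpoly F[N]},
        [/\ r != 0, indep i r & mdvd c (r * a)]) ->
     mdvd c a) ->
  (forall i : 'I_N, exists r : {poly {mpoly F[N]}}, [/\ r != 0, forall k, indep i r`_k &
     exists T : {poly {mpoly F[N]}}, r * h = c%:P * T]) ->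
  exists h' : {poly {mpoly F[N]}}, h = c%:P * h'.
Proof.
move=> IH; have [n] := ubnP (size h); elim: n h => // n IHn h hn hyp.
have [->|h0] := eqVneq h 0; first by exists 0; rewrite mulr0.
have [s hs] : mdvd c (lead_coef h).
  apply: IH => i; have [r [r0 ri [T rT]]] := hyp i.
  exists (lead_coef r); split; rewrite ?lead_coef_eq0 //.
    by rewrite lead_coefE; exact: ri.
  by exists (lead_coef T); rewrite -lead_coefM rT lead_coefM lead_coefC.
pose d := (size h).-1; pose t := lead_coef h *: 'X^d.
have tE : t = c%:P * (s *: 'X^d).
  by rewrite /t hs mul_polyC scalerA.
have [h' hh'] : exists h' : {poly {mpoly F[N]}}, h - t = c%:P * h'.
  apply: IHn.
    rewrite -ltnS (leq_trans _ hn) // ltnS.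
    have sh0 : (0 < size h)%N by rewrite size_poly_gt0.
    rewrite -(prednK sh0) ltnS -/d; apply/leq_sizeP => j.
    rewrite leq_eqVlt => /predU1P[<-|hj].
      by rewrite coefB coefZ coefXn eqxx mulr1 subrr.
    rewrite coefB coefZ coefXn gtn_eqF // mulr0 subr0 nth_default //.
    by rewrite -(prednK sh0).
  move=> i; have [r [r0 ri [T rT]]] := hyp i; exists r; split => //.
  exists (T - r * (s *: 'X^d)).
  by rewrite mulrBr rT tE mulrBr mulrCA.
by exists (h' + s *: 'X^d); rewrite mulrDr -hh' -tE subrK.
Qed.

(** This is unique factorization in disguise: in lowest terms the denominator of
    P / Q divides every r, so it involves no variable. The induction on the
    number of variables takes c to be the multiplier free of the last one. *)
Lemma mdvd_indep N (Q P : {mpoly F[N]}) : Q != 0 ->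
  (forall i, exists r : {mpoly F[N]}, [/\ r != 0, indep i r & mdvd Q (r * P)]) -> mdvd Q P.
Proof.
elim: N Q P => [|N IH] Q P Q0 hyp.
  exists ((Q@_0%MM)^-1 *: P); rewrite [Q]nvar0_mpolyC mul_mpolyC mcoeffC eqxx mulr1.
  rewrite scalerA divff ?scale1r //.
  by apply: contraNneq Q0 => Q00; rewrite [Q]nvar0_mpolyC Q00 mpolyC0.
have [r [r0 /indep_last_muni[c rc] [S rS]]] := hyp ord_max.
have c0 : c != 0.
  by apply: contraNneq r0 => c0; rewrite -[r]muniK rc c0 unmuniC mwiden0.
have [|i|h' hh'] := @mdvd_coefs _ c (muni S); first by move=> a; exact: IH.
  have [ri [ri0 ii [T riT]]] := hyp (widen_ord (leqnSn N) i).
  (* Q S = r P and Q T = ri P give r T = ri S *)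
  exists (muni ri); split.
  - by apply: contraNneq ri0 => ri0; rewrite -[ri]muniK ri0 unmuni0.
  - by move=> k; exact: indep_coef_muni.
  exists (muni T); have e : ri * S = r * T.
    by apply: (mulfI Q0); rewrite mulrCA -rS mulrCA riT mulrCA.
  by have := congr1 (@muni _ _) e; rewrite !muniM rc.
exists (unmuni h'); apply: (mulfI r0).
rewrite rS; rewrite mulrCA; congr (_ * _).
by rewrite -[S]muniK hh' unmuniM -rc muniK.
Qed.

(** * Divisibility can be tested on lines parallel to the axes *)

Definition upd N (x : 'I_N -> F) i t : 'I_N -> F := fun j => if j == i then t else x j.

Definition on_line N i (x : 'I_N -> F) (P : {mpoly F[N]}) : {poly F} :=
  mmap polyC (fun j => if j == i then 'X else (x j)%:P) P.

Lemma on_lineM N i (x : 'I_N -> F) : {morph on_line i x : P Q / P * Q}.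
Proof. exact: rmorphM. Qed.

Lemma on_lineD N i (x : 'I_N -> F) : {morph on_line i x : P Q / P + Q}.
Proof. exact: mmapD. Qed.

Lemma on_line_horner N i (x : 'I_N -> F) P t : (on_line i x P).[t] = P.@[upd x i t].
Proof.
elim/mpoly_gen_ind: P => [c|j|p q hp hq|p q hp hq].
- by rewrite /on_line mmapC hornerC mevalC.
- rewrite /on_line mmapX mmap1U mevalXU /upd.
  by case: eqP => _; rewrite ?hornerX ?hornerC.
- by rewrite on_lineD hornerD mevalD; congr (_ + _).
- by rewrite on_lineM hornerM mevalM; congr (_ * _).
Qed.

(** P as a polynomial in the variable i. The coefficients stay in the same ring,
    although they are free of that variable, so that all i are treated alike. *)
Definition isolate N i (P : {mpoly F[N]}) : {poly {mpoly F[N]}} :=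
  mmap (polyC \o @mpolyC N F) (fun j => if j == i then 'X else ('X_j)%:P) P.

Lemma isolateM N i : {morph @isolate N i : P Q / P * Q}.
Proof. exact: rmorphM. Qed.

Lemma isolateD N i : {morph @isolate N i : P Q / P + Q}.
Proof. exact: mmapD. Qed.

Lemma at_point_isolate N i x (P : {mpoly F[N]}) : at_point x (isolate i P) = on_line i x P.
Proof.
elim/mpoly_gen_ind: P => [c|j|p q hp hq|p q hp hq].
- by rewrite /isolate /on_line !mmapC at_pointC mevalC.
- rewrite /isolate /on_line !mmapX !mmap1U.
  by case: eqP => _; rewrite ?at_pointX // at_pointC mevalXU.
- by rewrite isolateD on_lineD at_pointD; congr (_ + _).
- by rewrite isolateM on_lineM at_pointM; congr (_ * _).
Qed.

Lemma isolateK N i (P : {mpoly F[N]}) : (isolate i P).['X_i] = P.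
Proof.
elim/mpoly_gen_ind: P => [c|j|p q hp hq|p q hp hq].
- by rewrite /isolate mmapC /= hornerC.
- by rewrite /isolate mmapX mmap1U; case: eqP => [->|_]; rewrite ?hornerX ?hornerC.
- by rewrite isolateD hornerD; congr (_ + _).
- by rewrite isolateM hornerM; congr (_ * _).
Qed.

(** Pseudo-division in the variable i gives l P = S Q + r, with l free of that
    variable and r of smaller degree. On a general line Q divides P, hence r
    vanishes there, so r = 0 and l is a multiplier for [mdvd_indep]. *)
Lemma mdvd_lines N (H Q P : {mpoly F[N]}) : H != 0 -> Q != 0 ->
  (forall x i, H.@[x] != 0 -> on_line i x Q != 0 -> on_line i x Q %| on_line i x P) ->
  mdvd Q P.
Proof.
move=> H0 Q0 hyp; apply: mdvd_indep => // i.
pose p := isolate i P; pose q := isolate i Q.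
have q0 : q != 0 by apply: contraNneq Q0 => q0; rewrite -(isolateK i Q) -/q q0 horner0.
pose l := lead_coef q ^+ scalp p q.
have l0 : l != 0 by rewrite expf_neq0 // lead_coef_eq0.
have pqE : l *: p = (p %/ q) * q + p %% q by exact: Pdiv.Idomain.divp_eq.
have pqx x : (l.@[x])%:P * on_line i x P
             = at_point x (p %/ q) * on_line i x Q + at_point x (p %% q).
  by rewrite -!at_point_isolate -at_pointC -!at_pointM -at_pointD -pqE mul_polyC.
have mod0 : p %% q = 0.
  apply/polyP => k; rewrite coef0.
  apply: (meval_dense (H := H * lead_coef q)) => [|x].
    by rewrite mulf_neq0 // lead_coef_eq0.
  rewrite meval0 mevalM mulf_eq0 negb_or => /andP[Hx lqx].
  have szQ : size (on_line i x Q) = size q.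
    by rewrite -at_point_isolate; exact: size_map_poly_id0.
  have Qx0 : on_line i x Q != 0 by rewrite -size_poly_eq0 szQ size_poly_eq0.
  have : on_line i x Q %| at_point x (p %% q).
    rewrite -(dvdp_addr _ (dvdp_mulIr (at_point x (p %/ q)) _)) -pqx.
    by rewrite dvdp_mull // hyp.
  rewrite -coef_at_point; have [->|r0] := eqVneq (at_point x (p %% q)) 0.
    by rewrite coef0.
  move=> /(dvdp_leq r0); rewrite szQ leqNgt => /negP[].
  by apply: leq_ltn_trans (size_poly _ _) _; rewrite ltn_modp.
exists l; split => //.
  move=> x y xy; rewrite /l !rmorphXn /=; congr (_ ^+ _).
  rewrite lead_coefE -!coef_at_point !at_point_isolate.
  suff -> : on_line i x Q = on_line i y Q by [].
  apply: poly_fun_eq => t; rewrite !on_line_horner; apply: meval_eq => j.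
  by rewrite /upd; case: eqP => // /eqP; exact: xy.
exists (p %/ q).['X_i]; move: (isolateK i P) (isolateK i Q) pqE.
rewrite -/p -/q mod0 addr0; clearbody p q => pX qX /(congr1 (horner^~ 'X_i)).
by rewrite hornerZ hornerM pX qX => ->; rewrite mulrC.
Qed.

(** * Regular functions and integral fractions *)

Lemma coprime_parts (a b : {poly F}) : b != 0 ->
  exists g a' b' : {poly F}, [/\ g != 0, a = a' * g, b = b' * g & coprimep a' b'].
Proof.
move=> b0; exists (gcdp a b), (a %/ gcdp a b), (b %/ gcdp a b); split.
- by rewrite gcdp_eq0 negb_and b0 orbT.
- by rewrite divpK ?dvdp_gcdl.
- by rewrite divpK ?dvdp_gcdr.
- by apply: coprimep_div_gcd; rewrite b0 orbT.
Qed.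

(** Let f = P / Q near one point. On a line contained in U, a root of the reduced
    denominator of P / Q would be a point where f is not a quotient a / b with b
    nonzero; so Q divides P on general lines, hence everywhere. *)
Lemma hartogs N (i0 : 'I_N) (U : ('I_N -> F) -> Prop) (f : ('I_N -> F) -> F)
    (H : {mpoly F[N]}) : H != 0 ->
  (forall x i t, H.@[x] != 0 -> U (upd x i t)) ->
  (forall z, U z -> exists a b : {mpoly F[N]}, b.@[z] != 0 /\
     forall y, U y -> b.@[y] != 0 -> f y = a.@[y] / b.@[y]) ->
  exists G : {mpoly F[N]}, forall z, U z -> f z = G.@[z].
Proof.
move=> H0 HU loc.
have UH x : H.@[x] != 0 -> U x.
  move=> Hx; have := HU x i0 (x i0) Hx; suff -> : upd x i0 (x i0) = x by [].
  by apply/funext => j; rewrite /upd; case: eqP => [->|].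
have [z0 /UH/loc[P [Q [Qz0 PQ]]]] := meval_neq0 H0.
have Q0 : Q != 0 by apply: contraNneq Qz0 => ->; rewrite meval0.
have cross z a b : U z -> b.@[z] != 0 ->
    (forall y, U y -> b.@[y] != 0 -> f y = a.@[y] / b.@[y]) -> Q * a = P * b.
  move=> Uz bz ab; have b0 : b != 0 by apply: contraNneq bz => ->; rewrite meval0.
  apply: (meval_dense (H := H * (Q * b))) => [|x]; first by rewrite !mulf_neq0.
  rewrite !mevalM !mulf_eq0 !negb_or => /and3P[/UH Ux Qx bx].
  have /eqP := PQ x Ux Qx; rewrite (ab x Ux bx) eqr_div // => /eqP <-.
  exact: mulrC.
have [G PG] : mdvd Q P.
  apply: (mdvd_lines H0 Q0) => x i Hx; set q := on_line i x Q; set p := on_line i x P.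
  move=> q0; have [g [p' [q' [g0 pE qE cop]]]] := coprime_parts p q0.
  have [q1|/closed_rootP[t qt]] := eqVneq (size q') 1.
    rewrite qE pE dvdp_mul2r //; move: q1 => /eqP.
    by rewrite size_poly_eq1 => /eqp_dvdl ->; rewrite dvd1p.
  have /loc[a [b [bt ab]]] := HU x i t Hx.
  have := cross _ _ _ (HU x i t Hx) bt ab.
  move=> /(congr1 (on_line i x)); rewrite !on_lineM -/q -/p qE pE.
  rewrite ![_ * g]mulrC -!mulrA => /(mulfI g0)/(congr1 (horner^~ t)).
  rewrite !hornerM (rootP qt) mul0r on_line_horner => /esym/eqP.
  rewrite mulf_eq0 (negPf bt) orbF => pt.
  by have := coprimep_root cop (x := t); rewrite rootE pt => /(_ isT); rewrite (rootP qt) eqxx.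
exists G => z Uz; have [a [b [bz ab]]] := loc z Uz.
rewrite (ab z Uz bz); have := cross z a b Uz bz ab.
rewrite PG -mulrA => /(mulfI Q0) ->; rewrite mevalM mulfK //.
Qed.

Lemma dvdp_integral (N : nat) (a b : {poly F}) (c : 'I_N -> {poly F}) : b != 0 ->
  a ^+ N + \sum_(i < N) c i * a ^+ i * b ^+ (N - i) = 0 -> b %| a.
Proof.
move=> b0; have [g [a' [b' [g0 aE bE cop]]]] := coprime_parts a b0.
have E i : c i * a ^+ i * b ^+ (N - i) = c i * a' ^+ i * b' ^+ (N - i) * g ^+ N.
  have -> : g ^+ N = g ^+ i * g ^+ (N - i) by rewrite -exprD subnKC // ltnW.
  by rewrite aE bE !exprMn; ring.
under eq_bigr do rewrite E.
rewrite {1}aE exprMn -mulr_suml -mulrDl => /eqP.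
rewrite mulf_eq0 expf_eq0 (negPf g0) andbF orbF addr_eq0 => /eqP e.
have : b' %| a' ^+ N.
  rewrite e dvdpNr; elim/big_ind: _ => [|p q|i _]; [exact: dvdp0|exact: dvdp_add|].
  by rewrite dvdp_mull // -(@prednK (N - i)) ?subn_gt0 // exprS dvdp_mulr.
rewrite aE bE dvdp_mul2r //.
have [b1|/closed_rootP[t bt] /dvdpP[s ab]] := eqVneq (size b') 1.
  by move: b1 => /eqP; rewrite size_poly_eq1 => /eqp_dvdl b1 _; rewrite b1 dvd1p.
have a't : a'.[t] = 0.
  have /eqP := congr1 (horner^~ t) ab.
  by rewrite /= hornerM (rootP bt) mulr0 horner_exp expf_eq0 => /andP[_ /eqP].
by have := coprimep_root cop (x := t); rewrite rootE a't (rootP bt) eqxx => /(_ isT).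
Qed.

(** Polynomial rings are integrally closed: in one variable by coprimality, and
    then by restriction to lines. *)
Lemma mdvd_integral M N (a b : {mpoly F[M]}) (c : 'I_N -> {mpoly F[M]}) : b != 0 ->
  a ^+ N + \sum_(i < N) c i * a ^+ i * b ^+ (N - i) = 0 -> mdvd b a.
Proof.
move=> b0 e; apply: (mdvd_lines b0 b0) => x i _ bx.
apply: (@dvdp_integral N _ _ (fun j => on_line i x (c j))) => //.
have := congr1 (on_line i x) e; rewrite /on_line mmap0 => {2}<-.
rewrite rmorphD rmorphXn /=; congr (_ + _).
by rewrite rmorph_sum /=; apply: eq_bigr => j _; rewrite !rmorphM !rmorphXn.
Qed.

End PolynomialFunctions.

(** * The first fundamental theorem for SL_2 *)

Section FFT.
Variables (F : numClosedFieldType) (n : nat).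
Local Notation poly2 := {mpoly F[n + n]}.
Local Notation point := ('I_(n + n) -> F).
Local Notation X i := ('X_(lshift n i) : poly2).
Local Notation Y i := ('X_(rshift n i) : poly2).
Local Notation Dx i G := (mderiv (lshift n i) G).
Local Notation Dy i G := (mderiv (rshift n i) G).

Definition bracket i j : poly2 := X i * Y j - X j * Y i.

Definition bracket_prod (s : seq ('I_n * 'I_n)) : poly2 :=
  \prod_(e <- s) bracket e.1 e.2.

(** The raising operator of sl_2, the sum of the u_j d/dv_j. *)
Definition polarize (G : poly2) : poly2 := \sum_j X j * Dy j G.

(** Cayley's operator, dual to the bracket. *)
Definition omega i j (G : poly2) : poly2 := Dy j (Dx i G) - Dy i (Dx j G).

Lemma DxX i j : Dx i (X j) = (i == j)%:R.
Proof.
rewrite mderivX mnmE (inj_eq (@lshift_inj _ _)) eq_sym; case: eqP => [->|_].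
  by rewrite scale1r -mpolyX0; congr mpolyX; apply/mnmP => k; rewrite mnmE subnn mnmE.
by rewrite scale0r.
Qed.

Lemma DxY i j : Dx i (Y j) = 0.
Proof. by rewrite mderivX mnmE eq_rlshift scale0r. Qed.

Lemma DyX i j : Dy i (X j) = 0.
Proof. by rewrite mderivX mnmE eq_lrshift scale0r. Qed.

Lemma polarize_Dy j G : polarize (Dy j G) = Dy j (polarize G).
Proof.
rewrite /polarize linear_sum; apply: eq_bigr => k _ /=.
by rewrite mderivM DyX mul0r add0r mderiv_comm.
Qed.

Lemma polarize_Dx i G : polarize (Dx i G) = Dx i (polarize G) - Dy i G.
Proof.
have -> : Dx i (polarize G) = \sum_j ((i == j)%:R * Dy j G + X j * Dx i (Dy j G)).
  by rewrite /polarize linear_sum; apply: eq_bigr => k _ /=; rewrite mderivM DxX.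
rewrite big_split /= (bigD1 i) //= eqxx mul1r big1 ?addr0 => [|k ki].
  rewrite addrC addrK; apply: eq_bigr => k _; by rewrite mderiv_comm.
by rewrite eq_sym (negPf ki) mul0r.
Qed.

Lemma polarizeB G H : polarize (G - H) = polarize G - polarize H.
Proof. by rewrite /polarize -sumrB; apply: eq_bigr => k _; rewrite mderivB mulrBr. Qed.

(** The commutator of the raising operator with d/du_i is - d/dv_i, and the two
    second derivatives in v that it produces cancel. *)
Lemma polarize_omega i j G : polarize G = 0 -> polarize (omega i j G) = 0.
Proof.
move=> G0; rewrite /omega polarizeB.
have E k l : polarize (Dy l (Dx k G)) = - Dy l (Dy k G).
  by rewrite polarize_Dy polarize_Dx G0 mderiv0 sub0r mderivN.
by rewrite (E i j) (E j i) mderiv_comm subrr.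
Qed.

(** Capelli's identity. Expand bracket i j * omega i j. Two of the four sums are
    the product of the Euler operators in u and in v. In the other two, moving
    d/du_i to the left past u_j produces the raising operator, which kills G,
    and a commutator, which sums to the Euler operator in v. *)
Lemma capelli e G : polarize G = 0 ->
  \sum_i X i * Dx i G = e%:R *: G -> \sum_j Y j * Dy j G = e%:R *: G ->
  \sum_i \sum_j bracket i j * omega i j G = (2 * e * e.+1)%:R *: G.
Proof.
move=> G0 GX GY.
pose S := \sum_i \sum_j X i * Y j * Dy j (Dx i G).
pose T := \sum_i \sum_j Y i * X j * Dy j (Dx i G).
have SE : S = (e * e)%:R *: G.
  rewrite natrM -scalerA -GX scaler_sumr; apply: eq_bigr => i _.
  under eq_bigr do rewrite -mulrA.
  rewrite -mulr_sumr scalerAr; congr (_ * _); rewrite -mderivZ -GY linear_sum /=.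
  by apply: eq_bigr => j _; rewrite mderivM DxY mul0r add0r mderiv_comm.
have TE : T = - (e%:R *: G).
  rewrite -GY -sumrN; apply: eq_bigr => i _.
  under eq_bigr do rewrite -mulrA.
  rewrite -mulr_sumr -mulrN; congr (_ * _).
  by have := polarize_Dx i G; rewrite G0 mderiv0 sub0r => <-.
transitivity (S - T - T + S).
  have S' : S = \sum_i \sum_j X j * Y i * Dy i (Dx j G) by exact: exchange_big.
  have T' : T = \sum_i \sum_j Y j * X i * Dy i (Dx j G) by exact: exchange_big.
  rewrite {2}S' {2}T' /S /T -!sumrB -big_split /=; apply: eq_bigr => i _.
  rewrite -!sumrB -big_split /=; apply: eq_bigr => j _.
  by rewrite /bracket /omega; ring.
rewrite SE TE -scaleNr -!scalerBl -scalerDl; congr (_ *: _).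
by rewrite !natrM -[in RHS]addn1 natrD; ring.
Qed.

Lemma euler (P : pred 'I_(n + n)) e (G : poly2) :
  (forall m, G@_m != 0 -> (\sum_(k | P k) m k = e)%N) ->
  \sum_(k | P k) 'X_k * G^`M(k) = e%:R *: G.
Proof.
move=> Ge; rewrite {2}[G]mpolyE scaler_sumr.
under eq_bigr => k _.
  rewrite {1}[G]mpolyE linear_sum mulr_sumr /=.
  under eq_bigr => m _.
    rewrite mderivZ mderivX -scalerAr -scalerAr scalerA -mpolyXD.
  over.
over.
rewrite exchange_big /= big_seq [RHS]big_seq; apply: eq_bigr => m mG.
rewrite -(Ge m) -?mcoeff_msupp // natr_sum scaler_suml; apply: eq_bigr => k _.
rewrite scalerA mulrC; have [->|mk] := eqVneq (m k) 0%N; first by rewrite mul0r !scale0r.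
by congr (_ *: 'X_[_]); rewrite addmC submK // lep1mP.
Qed.

(** The degree that omega i j removes from the columns i and j is recorded in
    off, so that D stays fixed along the induction of [fft]. *)
Definition balanced e (off D : 'I_n -> nat) (m : 'X_{1.. n + n}) :=
  [/\ (\sum_i m (lshift n i) = e)%N, (\sum_i m (rshift n i) = e)%N &
      forall k, (m (lshift n k) + m (rshift n k) + off k = D k)%N].

Definition deg (s : seq ('I_n * 'I_n)) k : nat :=
  (\sum_(e <- s) ((e.1 == k) + (e.2 == k)))%N.

Definition bracket_span (P : seq ('I_n * 'I_n) -> Prop) (G : poly2) :=
  exists L : seq (F * seq ('I_n * 'I_n)),
    (forall p, p \in L -> P p.2) /\ G = \sum_(p <- L) p.1 *: bracket_prod p.2.

Lemma bracket_span0 P : bracket_span P 0.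
Proof. by exists [::]; split=> //; rewrite big_nil. Qed.

Lemma bracket_spanD P G H : bracket_span P G -> bracket_span P H -> bracket_span P (G + H).
Proof.
move=> [L [PL ->]] [M [PM ->]]; exists (L ++ M); rewrite big_cat; split=> // p.
by rewrite mem_cat => /orP[/PL|/PM].
Qed.

Lemma bracket_spanZ P c G : bracket_span P G -> bracket_span P (c *: G).
Proof.
move=> [L [PL ->]]; exists [seq (c * p.1, p.2) | p <- L]; split.
  by move=> _ /mapP[p /PL Pp ->].
by rewrite big_map scaler_sumr; apply: eq_bigr => p _; rewrite scalerA.
Qed.

Lemma bracket_spanM (P Q : seq ('I_n * 'I_n) -> Prop) i j G :
  (forall s, P s -> Q ((i, j) :: s)) ->
  bracket_span P G -> bracket_span Q (bracket i j * G).
Proof.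
move=> PQ [L [PL ->]]; exists [seq (p.1, (i, j) :: p.2) | p <- L]; split.
  by move=> _ /mapP[p /PL Pp ->]; exact: PQ.
rewrite big_map mulr_sumr; apply: eq_bigr => p _.
by rewrite /bracket_prod big_cons scalerAr.
Qed.

Lemma udegU (i : 'I_n) : (\sum_(k < n) U_(lshift n i)%MM (lshift n k) = 1)%N.
Proof.
rewrite (bigD1 i) //= mnm1E eqxx big1 // => k ki.
by rewrite mnm1E (inj_eq (@lshift_inj _ _)) eq_sym (negPf ki).
Qed.

Lemma vdegU (i : 'I_n) : (\sum_(k < n) U_(rshift n i)%MM (rshift n k) = 1)%N.
Proof.
rewrite (bigD1 i) //= mnm1E eqxx big1 // => k ki.
by rewrite mnm1E (inj_eq (@rshift_inj _ _)) eq_sym (negPf ki).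
Qed.

Lemma balanced_omega e off D i j m :
  balanced e.+1 off D (m + U_(rshift n j) + U_(lshift n i))%MM ->
  balanced e (fun k => (i == k) + (j == k) + off k)%N D m.
Proof.
move=> [ul vl cl]; split.
- move: ul; under eq_bigr do rewrite !mnmDE.
  rewrite !big_split /= udegU [W in (_ + W + _)%N]big1 ?addn0 ?addn1; first by case.
  by move=> k _; rewrite mnm1E eq_rlshift.
- move: vl; under eq_bigr do rewrite !mnmDE.
  rewrite !big_split /= vdegU [W in (_ + W)%N]big1 ?addn0 ?addn1; first by case.
  by move=> k _; rewrite mnm1E eq_lrshift.
- move=> k; rewrite -(cl k) !mnmDE !mnm1E !(inj_eq (@lshift_inj _ _)).
  by rewrite !(inj_eq (@rshift_inj _ _)) eq_rlshift eq_lrshift; lia.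
Qed.

Lemma omega_supp e off D i j G : (forall m, G@_m != 0 -> balanced e.+1 off D m) ->
  forall m, (omega i j G)@_m != 0 ->
    balanced e (fun k => (i == k) + (j == k) + off k)%N D m.
Proof.
move=> GD m; rewrite mcoeffB !mcoeff_deriv -!mulrnA => nz.
have [G0|/GD/balanced_omega//] := eqVneq G@_(m + U_(rshift n j) + U_(lshift n i)) 0.
move: nz; rewrite G0 mul0rn sub0r oppr_eq0 mulrn_eq0 negb_or => /andP[_].
move=> /GD/balanced_omega [ul vl cl]; split=> // k.
by rewrite -(cl k) [(_ + (i == k))%N]addnC.
Qed.

(** Capelli's identity writes G as a combination of the bracket i j * omega i j G,
    and omega i j G is again invariant, of degree one less in u and in v. *)
Lemma fft e off D G : (forall m, G@_m != 0 -> balanced e off D m) -> polarize G = 0 ->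
  bracket_span (fun s => forall k, (deg s k + off k = D k)%N) G.
Proof.
elim: e off G => [|e IH] off G GD G0.
  have [->|Gn0] := eqVneq G 0; first exact: bracket_span0.
  have Gm m : G@_m != 0 -> m = 0%MM.
    move=> /GD[/eqP um /eqP vm _]; apply/mnmP => k; rewrite mnm0E.
    move: um vm; rewrite !sum_nat_eq0 => /forallP um /forallP vm.
    by case: (split_ordP k) => i ->; apply/eqP; [exact: um|exact: vm].
  have [m Gm0] : exists m, G@_m != 0.
    by exists (mlead G); rewrite mleadc_eq0.
  have [_ _ cm] := GD m Gm0; move: cm; rewrite (Gm m Gm0) => cm.
  exists [:: (G@_0%MM, [::])]; split.
    by move=> p /[!inE]/eqP-> k /=; rewrite /deg big_nil -(cm k) !mnm0E.
  rewrite big_seq1 /bracket_prod big_nil; apply/mpolyP => k.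
  rewrite mcoeffZ mcoeff1; have [->|k0] := eqVneq k 0%MM; first by rewrite mulr1.
  by rewrite mulr0; apply/eqP; apply: contraNT k0 => /Gm ->.
have GX : \sum_i X i * Dx i G = e.+1%:R *: G.
  rewrite -(@euler (fun k => (k < n)%N)) => [|m /GD[<- _ _]].
    by rewrite big_split_ord /= [W in _ = _ + W]big_pred0 ?addr0;
     [apply: eq_bigl => i; rewrite ltn_ord|move=> i; rewrite ltnNge leq_addr].
  by rewrite big_split_ord /= [W in (_ + W)%N]big_pred0 ?addn0;
     [apply: eq_bigl => i; rewrite ltn_ord|move=> i; rewrite ltnNge leq_addr].
have GY : \sum_i Y i * Dy i G = e.+1%:R *: G.
  rewrite -(@euler (fun k => (n <= k)%N)) => [|m /GD[_ <- _]].
    by rewrite big_split_ord /= [W in _ = W + _]big_pred0 ?add0r;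
     [apply: eq_bigl => i; rewrite leq_addr|move=> i; rewrite leqNgt ltn_ord].
  by rewrite big_split_ord /= [W in (W + _)%N]big_pred0 ?add0n;
     [apply: eq_bigl => i; rewrite leq_addr|move=> i; rewrite leqNgt ltn_ord].
have c0 : (2 * e.+1 * e.+2)%:R != 0 :> F by rewrite pnatr_eq0.
rewrite -[G]scale1r -(mulVf c0) -scalerA -(capelli G0 GX GY).
apply: bracket_spanZ; elim/big_ind: _; [exact: bracket_span0|exact: bracket_spanD|].
move=> i _; elim/big_ind: _; [exact: bracket_span0|exact: bracket_spanD|] => j _.
apply: (bracket_spanM _ (IH _ _ (omega_supp (i := i) (j := j) GD) (polarize_omega i j G0))).
by move=> s sD k; rewrite -(sD k) /deg big_cons /=; lia.
Qed.

(** * Consequences of invariance for coefficients *)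

Definition shear (x : point) t : point := fun k =>
  match split k with inl _ => x k | inr i => x k + t * x (lshift n i) end.

Definition along (x d : point) (G : poly2) : {poly F} :=
  mmap polyC (fun k => (x k)%:P + (d k)%:P * 'X) G.

Lemma alongD x d : {morph along x d : P Q / P + Q}.
Proof. exact: mmapD. Qed.

Lemma alongM x d : {morph along x d : P Q / P * Q}.
Proof. exact: rmorphM. Qed.

Lemma along_horner x d G t : (along x d G).[t] = G.@[fun k => x k + d k * t].
Proof.
elim/mpoly_gen_ind: G => [c|j|p q hp hq|p q hp hq].
- by rewrite /along mmapC hornerC mevalC.
- by rewrite /along mmapX mmap1U mevalXU !hornerE.
- by rewrite alongD hornerD mevalD; congr (_ + _).
- by rewrite alongM hornerM mevalM; congr (_ * _).
Qed.

Lemma deriv_along x d G : (along x d G)^`().[0] = \sum_k d k * (G^`M(k)).@[x].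
Proof.
have at0 H : (along x d H).[0] = H.@[x].
  by rewrite along_horner; apply: meval_eq => k; rewrite mulr0 addr0.
elim/mpoly_gen_ind: G => [c|j|p q hp hq|p q hp hq].
- rewrite /along mmapC derivC horner0 big1 // => k _.
  by rewrite mderivC meval0 mulr0.
- rewrite /along mmapX mmap1U derivD derivC derivM derivC derivX !hornerE.
  rewrite (bigD1 j) //= big1 ?addr0 => [|k kj].
    rewrite mderivX mnm1E eqxx scale1r.
    by rewrite mevalX big1 ?mulr1 // => k _; rewrite mnmBE mnm1E subnn expr0.
  by rewrite mderivX mnm1E eq_sym (negPf kj) scale0r meval0 mulr0.
- rewrite alongD derivD hornerD hp hq -big_split; apply: eq_bigr => k _ /=.
  by rewrite mderivD mevalD mulrDr.
- rewrite alongM derivM hornerD !hornerM hp hq !at0 mulr_suml mulr_sumr -big_split.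
  by apply: eq_bigr => k _ /=; rewrite mderivM mevalD !mevalM; ring.
Qed.

(** The raising operator is the derivative of the shear v := v + t u at t = 0. *)
Lemma shear_polarize G : (forall x t, G.@[shear x t] = G.@[x]) -> polarize G = 0.
Proof.
move=> Gsh; apply: meval_fun_eq0 => x.
pose d : point := fun k => match split k with inl _ => 0 | inr i => x (lshift n i) end.
have Gc : along x d G = (G.@[x])%:P.
  apply: poly_fun_eq => t; rewrite hornerC along_horner -[RHS](Gsh x t).
  apply: meval_eq => k; rewrite /shear /d; case: split => i; last by rewrite mulrC.
  by rewrite mul0r addr0.
have := deriv_along x d G; rewrite Gc derivC horner0 => ->.
rewrite /polarize rmorph_sum /= big_split_ord /= [W in _ = W + _]big1 ?add0r.
  by apply: eq_bigr => i _; rewrite /d (unsplitK (inr i)) mevalM mevalXU.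
by move=> i _; rewrite /d (unsplitK (inl i)) mul0r.
Qed.

Lemma scaling_monomials (l : point) c (G : poly2) :
  (forall x, G.@[fun k => l k * x k] = c * G.@[x]) ->
  forall m, G@_m != 0 -> \prod_k l k ^+ m k = c.
Proof.
move=> Gl m Gm.
pose G' : poly2 := \sum_(m <- msupp G) (G@_m * \prod_k l k ^+ m k) *: 'X_[m].
have G'E : G' = c *: G.
  apply/eqP; rewrite -subr_eq0; apply/eqP/meval_fun_eq0 => x.
  rewrite mevalB mevalZ -Gl /G' rmorph_sum /= [W in _ - W]mevalE -sumrB big1 // => k _.
  rewrite mevalZ mevalX -mulrA -big_split /= -mulrBr; apply/eqP.
  rewrite mulf_eq0 subr_eq0 orbC; apply/orP; left; apply/eqP; apply: eq_bigr => i _.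
  by rewrite exprMn.
apply: (mulfI Gm); rewrite [RHS]mulrC -mcoeffZ -G'E /G' raddf_sum /=.
rewrite (bigD1_seq m) /= ?msupp_uniq ?mcoeff_msupp // mcoeffZ mcoeffX eqxx mulr1.
rewrite [W in _ = _ + W]big1 ?addr0 // => k km.
by rewrite mcoeffZ mcoeffX (negPf km) mulr0.
Qed.

End FFT.

(** * Regular multigraphs *)

Section Hall.
Local Open Scope nat_scope.
Variables T U : finType.
Implicit Types (N : T -> {set U}) (S : {set T}).

Definition neighbours N S := \bigcup_(x in S) N x.

Definition hall_condition N := [forall S : {set T}, #|S| <= #|neighbours N S|].

Lemma neighbours1 N x : neighbours N [set x] = N x.
Proof. by rewrite /neighbours big_set1. Qed.

Lemma neighboursU N S S' : neighbours N (S :|: S') = neighbours N S :|: neighbours N S'.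
Proof.
apply/setP => y; rewrite inE; apply/bigcupP/orP => [[x /setUP[xS|xS] yx]|].
- by left; apply/bigcupP; exists x.
- by right; apply/bigcupP; exists x.
- by case=> /bigcupP[x xS yx]; exists x => //; rewrite inE xS ?orbT.
Qed.

Lemma neighboursI N S S' : neighbours N (S :&: S') \subset neighbours N S :&: neighbours N S'.
Proof.
apply/subsetP => y /bigcupP[x /setIP[xS xS'] yx].
by rewrite inE; apply/andP; split; apply/bigcupP; exists x.
Qed.

Definition prune N x y : T -> {set U} := fun z => if z == x then N x :\ y else N z.

(** Only a set containing x can violate the condition after the deletion; A is that
    set without x. *)
Lemma prune_fail N x y : hall_condition N -> ~~ hall_condition (prune N x y) ->
  exists A : {set T}, x \notin A /\ #|neighbours N A :|: (N x :\ y)| <= #|A|.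
Proof.
move=> /forallP hN /forallPn[S]; rewrite -ltnNge => hS.
have eqN (B : {set T}) : x \notin B -> neighbours (prune N x y) B = neighbours N B.
  move=> xB; apply: eq_bigr => z zB; rewrite /prune; case: eqP => // zx.
  by rewrite zx (negPf xB) in zB.
have xS : x \in S.
  by apply: contraLR hS => xS; rewrite eqN // -leqNgt hN.
exists (S :\ x); rewrite !inE eqxx; split => //.
have SE : S = (S :\ x) :|: [set x] by rewrite setUC setD1K.
move: hS; rewrite {1}SE neighboursU eqN ?inE ?eqxx // neighbours1 /prune eqxx.
by rewrite [#|S|](cardsD1 x) xS.
Qed.

(** Hall's theorem, by Rado's argument. If N x has two elements y1 and y2, one of
    them can be deleted: otherwise there are violating sets A1 and A2, and the
    cardinals of the union and of the intersection of their neighbourhoods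
    contradict the condition for x |: (A1 :|: A2) and A1 :&: A2. When all the
    N x are singletons they are distinct. *)
Lemma hall N : hall_condition N -> exists f : T -> U, injective f /\ forall x, f x \in N x.
Proof.
have [k] := ubnP (\sum_x #|N x|); elim: k N => // k IH N sN hN.
have [/forallP N1|/forallPn[x]] := boolP [forall x, #|N x| <= 1].
  have N1' x : #|N x| = 1.
    by apply/eqP; rewrite eqn_leq N1; have /forallP/(_ [set x]) := hN;
       rewrite cards1 neighbours1.
  have /fin_all_exists[f fN] x : exists y, N x = [set y] by exact/cards1P/eqP.
  exists f; split => [x y fxy|x]; last by rewrite fN set11.
  apply/eqP; apply: contraT => xy; have /forallP/(_ [set x; y]) := hN.
  by rewrite neighboursU !neighbours1 !fN fxy setUid cards2 cards1 xy.
rewrite -ltnNge => /card_gt1P[y1 [y2 [y1x y2x y12]]].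
have IHp y : y \in N x -> hall_condition (prune N x y) ->
    exists f : T -> U, injective f /\ forall x, f x \in N x.
  move=> yx /IH[|f [finj fN]].
    rewrite -ltnS; apply: leq_trans sN; rewrite ltnS (bigD1 x) //= [X in _ <= X](bigD1 x) //=.
    rewrite {1}/prune eqxx [in X in _ <= X](cardsD1 y) yx add1n addSn ltnS.
    rewrite leq_add2l leq_eqVlt; apply/orP; left; apply/eqP; apply: eq_bigr => z zx.
    by rewrite /prune (negPf zx).
  exists f; split => // z; have := fN z; rewrite /prune; case: eqP => // ->.
  by case/setD1P.
have [/(IHp _ y1x)//|/(prune_fail hN)[A1 [xA1 hA1]]] := boolP (hall_condition (prune N x y1)).
have [/(IHp _ y2x)//|/(prune_fail hN)[A2 [xA2 hA2]]] := boolP (hall_condition (prune N x y2)).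
have := leq_add hA1 hA2; rewrite -cardsUI.
set P := neighbours N A1 :|: _; set Q := neighbours N A2 :|: _ => PQ.
have PUQ : neighbours N ((A1 :|: A2) :|: [set x]) \subset P :|: Q.
  rewrite !neighboursU neighbours1; apply/subsetP => y.
  rewrite !inE => /orP[/orP[->|->]|yx]; rewrite ?orbT // yx !andbT.
  by have [->|] := eqVneq y y1; rewrite ?y12 ?orbT.
have PIQ : neighbours N (A1 :&: A2) \subset P :&: Q.
  by apply: subset_trans (neighboursI _ _ _) _; apply: setISS; exact: subsetUl.
have /forallP hN' := hN.
have := leq_add (leq_trans (hN' _) (subset_leq_card PUQ)) (leq_trans (hN' _) (subset_leq_card PIQ)).
rewrite setUC cardsU1 !inE negb_or xA1 xA2 /= add1n addSn cardsUI => c.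
by have := leq_trans c PQ; rewrite ltnn.
Qed.

End Hall.

Section Multigraphs.
Local Open Scope nat_scope.
Variable V : finType.
Implicit Types s : seq (V * V).

Definition outdeg s k := \sum_(e <- s) (e.1 == k).
Definition indeg s k := \sum_(e <- s) (e.2 == k).

Definition swap (e : V * V) := (e.2, e.1).

(** A pair stands for an edge and the orientation chosen for it. *)
Definition same_edge (p : (V * V) * (V * V)) := (p.2 == p.1) || (p.2 == swap p.1).

Lemma outdeg_cons e s k : outdeg (e :: s) k = (e.1 == k) + outdeg s k.
Proof. by rewrite /outdeg big_cons. Qed.

Lemma indeg_cons e s k : indeg (e :: s) k = (e.2 == k) + indeg s k.
Proof. by rewrite /indeg big_cons. Qed.

Lemma perm_outdeg s s' k : perm_eq s s' -> outdeg s k = outdeg s' k.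
Proof. exact: perm_big. Qed.

Lemma perm_indeg s s' k : perm_eq s s' -> indeg s k = indeg s' k.
Proof. exact: perm_big. Qed.

(** Merge two edges a - b - c into a - c, orient the smaller graph, and let the
    path a - b - c follow the orientation of a - c. Such a path exists at any
    edge a - b that is not a loop, since b has even degree. *)
Lemma eulerian_orientation s : (forall k, ~~ odd (outdeg s k + indeg s k)) ->
  exists t : seq ((V * V) * (V * V)),
    [/\ perm_eq s (map fst t), all same_edge t &
        forall k, outdeg (map snd t) k = indeg (map snd t) k].
Proof.
have [m] := ubnP (size s); elim: m s => // m IH s sm ev.
have [/allP loops|/allPn[[a b] es ab]] := boolP (all (fun e => e.1 == e.2) s).
  exists [seq (e, e) | e <- s]; split.
  - by rewrite -map_comp map_id.
  - by apply/allP => _ /mapP[e _ ->]; rewrite /same_edge eqxx.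
  - by move=> k; rewrite -map_comp map_id; apply: eq_big_seq => e /loops/eqP ->.
rewrite /= in ab; have ps := perm_to_rem es; set s0 := rem _ _ in ps.
have sz0 : size s = (size s0).+1 by rewrite (perm_size ps).
have odd0 : odd (\sum_(e <- s0) ((e.1 == b) + (e.2 == b))).
  rewrite big_split -/(outdeg s0 b) -/(indeg s0 b).
  have := ev b; rewrite (perm_outdeg _ ps) (perm_indeg _ ps) outdeg_cons indeg_cons /=.
  by rewrite eqxx (negPf ab) add0n addnCA add1n /= negbK.
have [e2 e2s e2b] : exists2 e, e \in s0 & odd ((e.1 == b) + (e.2 == b)).
  apply/hasP; apply: contraLR odd0 => /hasPn no.
  rewrite big_seq; elim/big_ind: _ => // p q.
  by rewrite oddD => /negPf -> /negPf ->.
have {e2b} [c e2E] : exists c, e2 = (b, c) \/ e2 = (c, b).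
  case: e2 e2b {e2s} => x y /=; have [->|xb] := eqVneq x b; first by exists y; left.
  by have [->|yb] := eqVneq y b => // _; exists x; right.
have ps0 := perm_to_rem e2s; set r := rem _ _ in ps0.
have psr : perm_eq s ((a, b) :: e2 :: r).
  by apply: perm_trans ps _; rewrite perm_cons.
have [||t [pt st bt]] := IH ((a, c) :: r).
- by rewrite /= -ltnS (leq_trans _ sm) // ltnS sz0 (perm_size ps0).
- move=> k; have := ev k; rewrite (perm_outdeg _ psr) (perm_indeg _ psr).
  rewrite !outdeg_cons !indeg_cons /=.
  case: e2E => -> /=; rewrite !oddD !oddb;
   by case: (a == k); case: (b == k); case: (c == k); case: odd; case: odd.
have : (a, c) \in map fst t by rewrite -(perm_mem pt) mem_head.
case/mapP => -[e d] dt /= eE; have pt0 := perm_to_rem dt; set t0 := rem _ _ in pt0.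
have pr : perm_eq r (map fst t0).
  rewrite -(perm_cons (a, c)); apply: perm_trans pt _.
  by have := perm_map fst pt0; rewrite /= -eE.
have st0 : all same_edge t0 by apply/allP => p /mem_rem/(allP st).
have := allP st _ dt; rewrite /same_edge /= -eE => dE.
have bt0 k : (d.1 == k) + outdeg (map snd t0) k = (d.2 == k) + indeg (map snd t0) k.
  have := bt k; rewrite (perm_outdeg _ (perm_map snd pt0)) (perm_indeg _ (perm_map snd pt0)).
  by rewrite /= outdeg_cons indeg_cons.
case/orP: dE => /eqP dE; rewrite dE /= in bt0.
- exists [:: ((a, b), (a, b)), (e2, (b, c)) & t0]; split.
  + by apply: perm_trans psr _; rewrite /= !perm_cons.
  + by rewrite /= st0 /same_edge eqxx /= andbT; case: e2E => ->; rewrite /swap eqxx ?orbT.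
  + by move=> k; rewrite /= !outdeg_cons !indeg_cons /= addnCA bt0.
- exists [:: ((a, b), (b, a)), (e2, (c, b)) & t0]; split.
  + by apply: perm_trans psr _; rewrite /= !perm_cons.
  + rewrite /= st0 /same_edge eqxx /= andbT /swap /= orbT.
    by case: e2E => ->; rewrite eqxx ?orbT.
  + by move=> k; rewrite /= !outdeg_cons !indeg_cons /= bt0 addnCA.
Qed.

Definition perm_graph (f : {perm V}) : seq (V * V) := [seq (i, f i) | i <- enum V].

Lemma sum_outdeg s (S : {set V}) : \sum_(i in S) outdeg s i = \sum_(e <- s) (e.1 \in S).
Proof.
rewrite exchange_big; apply: eq_bigr => e _ /=.
have [eS|eS] := boolP (e.1 \in S); last first.
  by apply: big1 => i iS; case: eqP => // ei; rewrite ei iS in eS.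
by rewrite (bigD1 e.1) //= eqxx big1 // => i /andP[_ ie]; rewrite eq_sym (negPf ie).
Qed.

Lemma sum_indeg s (S : {set V}) : \sum_(i in S) indeg s i = \sum_(e <- s) (e.2 \in S).
Proof.
rewrite exchange_big; apply: eq_bigr => e _ /=.
have [eS|eS] := boolP (e.2 \in S); last first.
  by apply: big1 => i iS; case: eqP => // ei; rewrite ei iS in eS.
by rewrite (bigD1 e.2) //= eqxx big1 // => i /andP[_ ie]; rewrite eq_sym (negPf ie).
Qed.

(** Koenig's theorem: counting the edges out of S shows that a regular bipartite
    graph satisfies Hall's condition. *)
Lemma regular_perm m s : (forall k, outdeg s k = m.+1) -> (forall k, indeg s k = m.+1) ->
  exists (f : {perm V}) r, [/\ perm_eq s (perm_graph f ++ r),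
    forall k, outdeg r k = m & forall k, indeg r k = m].
Proof.
move=> so si.
have [|f [finj fN]] := @hall _ _ (fun i => [set j | (i, j) \in s]).
  apply/forallP => S; set N := neighbours _ S.
  rewrite -(leq_pmul2r (ltn0Sn m)) -[#|S|]sum1_card -[#|N|]sum1_card !big_distrl /=.
  under eq_bigr => i _ do rewrite mul1n -(so i).
  under [X in _ <= X]eq_bigr => i _ do rewrite mul1n -(si i).
  rewrite sum_outdeg sum_indeg big_seq [X in _ <= X]big_seq; apply: leq_sum => e es.
  case: (boolP (e.1 \in S)) => // eS; suff -> : e.2 \in N by [].
  by apply/bigcupP; exists e.1; rewrite // inE -surjective_pairing.
pose g : {perm V} := perm finj.
have gu : uniq (perm_graph g) by rewrite map_inj_uniq ?enum_uniq // => i j [].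
have : forall e, count_mem e (perm_graph g) <= count_mem e s.
  move=> e; rewrite count_uniq_mem //; case: (boolP (e \in _)) => // /mapP[i _ ->].
  by rewrite -has_count has_pred1 permE; have := fN i; rewrite inE.
move=> /count_subseqP[s1 /perm_to_subseq[r sr] gs1].
have psr : perm_eq s (perm_graph g ++ r).
  by apply: perm_trans sr _; rewrite perm_cat2r perm_sym.
have og k : outdeg (perm_graph g) k = 1.
  rewrite /outdeg big_map big_enum /= (bigD1 k) //= eqxx big1 // => i ik.
  by rewrite (negPf ik).
have ig k : indeg (perm_graph g) k = 1.
  rewrite /indeg big_map big_enum /= (bigD1 ((g^-1)%g k)) //= permKV eqxx big1 // => i ik.
  by case: eqP => // gk; rewrite -gk permK eqxx in ik.
exists g, r; split => // k.
  have := so k; rewrite (perm_outdeg _ psr) /outdeg big_cat /=.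
  by rewrite -/(outdeg (perm_graph g) k) og => -[].
have := si k; rewrite (perm_indeg _ psr) /indeg big_cat /=.
by rewrite -/(indeg (perm_graph g) k) ig => -[].
Qed.

Lemma regular_factorization m s :
  (forall k, outdeg s k = m) -> (forall k, indeg s k = m) ->
  exists L : seq {perm V}, size L = m /\ perm_eq s (flatten (map perm_graph L)).
Proof.
elim: m s => [|m IH] s so si.
  exists [::]; split => //; case: s so {si} => // e s /(_ e.1).
  by rewrite outdeg_cons eqxx.
have [f [r [sr ro ri]]] := regular_perm so si.
have [L [<- rL]] := IH r ro ri; exists (f :: L); split => //=.
by apply: perm_trans sr _; rewrite perm_cat2l.
Qed.

(** Petersen's 2-factor theorem: an Eulerian orientation makes the graph a regular
    bipartite graph between the tails and the heads of its edges. *)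
Lemma petersen m s : (forall k, outdeg s k + indeg s k = m.*2) ->
  exists (t : seq ((V * V) * (V * V))) (L : seq {perm V}),
    [/\ perm_eq s (map fst t), all same_edge t, size L = m &
        perm_eq (map snd t) (flatten (map perm_graph L))].
Proof.
move=> sd; have [|t [st tt bt]] := @eulerian_orientation s.
  by move=> k; rewrite sd odd_double.
have deg_same k : outdeg (map snd t) k + indeg (map snd t) k = m.*2.
  rewrite -(sd k) (perm_outdeg k st) (perm_indeg k st) /outdeg /indeg !big_map.
  rewrite -!big_split /= big_seq [RHS]big_seq; apply: eq_bigr => p /(allP tt).
  by rewrite /same_edge => /orP[]/eqP-> //=; rewrite addnC.
have to k : outdeg (map snd t) k = m.
  by have := deg_same k; rewrite -bt addnn => /double_inj.
have [L [Lm tL]] := regular_factorization to (fun k => etrans (esym (bt k)) (to k)).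
by exists t, L.
Qed.

End Multigraphs.

(** * Invariant polynomials *)

Section InvariantPolynomials.
Variables (F : numClosedFieldType) (n : nat).
Local Notation poly2 := {mpoly F[n + n]}.
Local Notation point := ('I_(n + n) -> F).

Lemma pow2_inj a b : 2 ^+ a * 2^-1 ^+ b = 1 :> F -> a = b.
Proof.
have u : 2 ^+ b != 0 :> F by rewrite expf_neq0 // pnatr_eq0.
rewrite exprVn => /(canRL (mulfVK u)) /eqP.
by rewrite mul1r -!natrX eqr_nat eqn_exp2l // => /eqP.
Qed.

Definition column (k : 'I_(n + n)) : 'I_n := match split k with inl i => i | inr i => i end.

Definition scale (l x : point) : point := fun k => l k * x k.

(** The element diag (2, 1/2) of SL_2. *)
Definition squeeze : point := fun k => if split k is inl _ then 2 else 2^-1.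

(** The diagonal of an element of T. *)
Definition weight (i j c : 'I_n) : F :=
  if c == i then 2 else if c == j then 2^-1 else 1.

Definition coweight (i j : 'I_n) : point := fun k => weight i j (column k).

(** These elements suffice: 2 is not a root of unity, so the diagonal ones detect
    the weights, and the shears are a maximal unipotent subgroup of SL_2. *)
Definition invariant (f : point -> F) :=
  [/\ forall x t, f (shear x t) = f x, forall x, f (scale squeeze x) = f x &
      forall i j, i != j -> forall x, f (scale (coweight i j) x) = f x].

Definition invariant_poly (G : poly2) := invariant (fun x => G.@[x]).

(** If c is the common column degree, then n c is twice the degree in u; n being
    odd, c is even. *)
Lemma invariant_monomial G m : odd n -> invariant_poly G -> G@_m != 0 ->
  exists d, balanced (n * d) (fun=> 0%N) (fun=> d.*2) m.
Proof.
move=> n_odd [_ sq tor] Gm.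
have ul : (\sum_i m (lshift n i) = \sum_i m (rshift n i))%N.
  have := @scaling_monomials F n squeeze 1 G (fun x => etrans (sq x) (esym (mul1r _))) m Gm.
  rewrite big_split_ord /=; under eq_bigr do rewrite /squeeze (unsplitK (inl _)).
  under [W in _ * W]eq_bigr do rewrite /squeeze (unsplitK (inr _)).
  by rewrite !prodrXr; exact: pow2_inj.
pose c k := (m (lshift n k) + m (rshift n k))%N.
have cE i j : c i = c j.
  have [->//|ij] := eqVneq i j.
  have := @scaling_monomials F n (coweight i j) 1 G
    (fun x => etrans (tor i j ij x) (esym (mul1r _))) m Gm.
  rewrite big_split_ord /= -big_split /=.
  under eq_bigr do rewrite /coweight /weight /column (unsplitK (inl _)) (unsplitK (inr _)) -exprD -/(c _).
  have ji : j != i by rewrite eq_sym.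
  rewrite (bigD1 i) //= eqxx (bigD1 j) //= (negPf ji) eqxx.
  rewrite big1 ?mulr1 => [|k /andP[/negPf -> /negPf ->]]; last by rewrite expr1n.
  exact: pow2_inj.
have n0 : (0 < n)%N by case: (n) n_odd.
pose i0 := Ordinal n0.
have tot : (n * c i0 = (\sum_i m (lshift n i)).*2)%N.
  rewrite -addnn {2}ul -big_split /= -[n in LHS]card_ord -sum_nat_const.
  by apply: eq_bigr => i _; exact: cE.
have c_even : ~~ odd (c i0).
  by have := congr1 odd tot; rewrite oddM n_odd odd_double => /= ->.
exists (c i0)./2; split.
- by apply: double_inj; rewrite -tot doubleMr even_halfK.
- by rewrite -ul; apply: double_inj; rewrite -tot doubleMr even_halfK.
- by move=> k; rewrite addn0 even_halfK // (cE i0 k).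
Qed.

Lemma mdeg_balanced e off D (m : 'X_{1.. n + n}) : balanced e off D m -> mdeg m = e.*2.
Proof. by move=> [ul vl _]; rewrite mdegE big_split_ord /= ul vl addnn. Qed.

Definition degree_part d (G : poly2) : poly2 := pihomog [measure of mdeg] d G.

Lemma coef_degree_part d G m : (degree_part d G)@_m = G@_m *+ (mdeg m == d).
Proof.
rewrite /degree_part pihomogE raddf_sum /= big_mkcond /=.
have [mG|mG] := boolP (m \in msupp G); last first.
  rewrite (memN_msupp_eq0 mG) mul0rn big_seq big1 // => k kG; case: ifP => // _.
  rewrite mcoeffZ mcoeffX (_ : (k == m) = false) ?mulr0 //.
  by apply: contraNF mG => /eqP <-.
rewrite (bigD1_seq m) ?msupp_uniq //= big1 ?addr0 => [|k km].
  by case: eqP => // _; rewrite mcoeffZ mcoeffX eqxx mulr1.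
by case: ifP => // _; rewrite mcoeffZ mcoeffX (negPf km) mulr0.
Qed.

Lemma polarize_degree_part d G : polarize (degree_part d G) = degree_part d (polarize G).
Proof.
have pZ c H : polarize (c *: H) = c *: polarize H.
  by rewrite /polarize scaler_sumr; apply: eq_bigr => j _; rewrite mderivZ scalerAr.
have pS (I : Type) (r : seq I) (f : I -> poly2) :
    polarize (\sum_(i <- r) f i) = \sum_(i <- r) polarize (f i).
  rewrite /polarize exchange_big; apply: eq_bigr => j _ /=.
  by rewrite linear_sum mulr_sumr.
have dS (I : Type) (r : seq I) (f : I -> poly2) :
    degree_part d (\sum_(i <- r) f i) = \sum_(i <- r) degree_part d (f i).
  exact: raddf_sum.
have dZ c H : degree_part d (c *: H) = c *: degree_part d H by exact: linearZ.
rewrite [G]mpolyE dS !pS dS; apply: eq_bigr => m _.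
rewrite dZ !pZ dZ; congr (_ *: _); rewrite /degree_part pihomogX /=.
have hom : polarize ('X_[m] : poly2) \is (mdeg m).-homog.
  rewrite /polarize; apply: rpred_sum => j _; rewrite mderivX.
  have [->|mj] := eqVneq (m (rshift n j)) 0%N; first by rewrite scale0r mulr0 rpred0.
  rewrite -scalerAr rpredZ // -mpolyXD dhomogX /=.
  rewrite mdegD mdeg1 -{2}[m](@submK _ U_(rshift n j)) ?lep1mP //.
  by rewrite mdegD mdeg1 addnC.
case: eqP => [md|/eqP md]; first by rewrite pihomog_dE // -md.
by rewrite (pihomog_ne0 md) // /polarize big1 // => j _; rewrite mderiv0 mulr0.
Qed.

(** The homogeneous components of an invariant polynomial are again invariant, and
    only the degrees 2 n k occur. *)
Lemma invariant_decomposition G : odd n -> invariant_poly G ->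
  (forall k, bracket_span (fun s => forall i, deg s i = k.*2)
     (degree_part (n * k).*2 G)) /\
  G = \sum_(k < msize G) degree_part (n * k).*2 G.
Proof.
move=> n_odd Ginv; have n0 : (0 < n)%N by case: (n) n_odd.
split=> [k|].
  have := @fft F n (n * k) (fun=> 0%N) (fun=> k.*2) (degree_part (n * k).*2 G).
  case=> [m||L [LP GE]]; last first.
  - by exists L; split=> // p /LP h i; rewrite -(h i) addn0.
  - rewrite polarize_degree_part shear_polarize ?linear0 //.
      by rewrite /degree_part pihomog0.
    by case: Ginv.
  rewrite coef_degree_part mulrn_eq0 negb_or eqb0 negbK => /andP[/eqP md].
  move=> /(invariant_monomial n_odd Ginv)[d bd].
  have := mdeg_balanced bd; rewrite md => /double_inj/eqP.
  by rewrite eqn_pmul2l // => /eqP ->.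
apply/mpolyP => m; rewrite raddf_sum /=.
have [Gm|Gm] := eqVneq G@_m 0.
  by rewrite Gm big1 // => k _; rewrite coef_degree_part Gm mul0rn.
have [d bd] := invariant_monomial n_odd Ginv Gm; have md := mdeg_balanced bd.
have dG : (d < msize G)%N.
  apply: leq_ltn_trans (msize_mdeg_lt (m := m) _); last by rewrite mcoeff_msupp.
  by rewrite md -addnn; nia.
rewrite (bigD1 (Ordinal dG)) //= coef_degree_part md eqxx big1 ?addr0 // => k kd.
rewrite coef_degree_part md; case: eqP => // /double_inj/eqP.
by rewrite eqn_pmul2l // eq_sym => /eqP kd'; case/eqP: kd; apply/val_inj.
Qed.

(** The product of Pluecker coordinates over the graph of a permutation; it is an
    invariant section of degree 1. *)
Definition perm_form (f : {perm 'I_n}) (w : 'M[F]_n) : F := \prod_i w i (f i).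

Definition form_sum (M : seq (F * seq {perm 'I_n})) (w : 'M[F]_n) : F :=
  \sum_(p <- M) p.1 * \prod_(f <- p.2) perm_form f w.

Definition pluecker (x : point) : 'M[F]_n :=
  \matrix_(i, j) (x (lshift n i) * x (rshift n j) - x (lshift n j) * x (rshift n i)).

Lemma meval_bracket i j x : (bracket F i j).@[x] = pluecker x i j.
Proof. by rewrite /bracket mevalB !mevalM !mevalXU mxE. Qed.

(** By Petersen's theorem; the sign comes from reversing edges. *)
Lemma bracket_span_forms k G : bracket_span (fun s => forall i : 'I_n, deg s i = k.*2) G ->
  exists M, all (fun p => size p.2 == k) M /\ forall x, G.@[x] = form_sum M (pluecker x).
Proof.
move=> [L [LP ->]].
have mono s : (forall i, deg s i = k.*2) -> exists c (P : seq {perm 'I_n}),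
    size P = k /\ forall x, (bracket_prod F s).@[x] = c * \prod_(f <- P) perm_form f (pluecker x).
  move=> sk; have [|t [P [st tt Pk tP]]] := @petersen _ k s.
    by move=> i; rewrite -(sk i) /deg big_split.
  have [c cE] : exists c : F, forall x, \prod_(p <- t) (bracket F p.1.1 p.1.2).@[x] =
      c * \prod_(e <- map snd t) (bracket F e.1 e.2).@[x].
    elim: t tt {st tP} => [_|p t IH /= /andP[pt /IH[c cE]]].
      by exists 1 => x; rewrite !big_nil mulr1.
    have [e eE] : exists e : F, forall x,
        (bracket F p.1.1 p.1.2).@[x] = e * (bracket F p.2.1 p.2.2).@[x].
      case/orP: pt => /eqP ->; first by exists 1 => x; rewrite mul1r.
      by exists (-1) => x; rewrite !meval_bracket !mxE /swap /=; ring.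
    by exists (e * c) => x; rewrite !big_cons cE eE; ring.
  exists c, P; split=> // x; rewrite /bracket_prod (perm_big _ st) big_map rmorph_prod /= cE.
  congr (_ * _); rewrite (perm_big _ tP) /= big_flatten big_map; apply: eq_bigr => f _.
  rewrite /perm_graph big_map big_enum; apply: eq_bigr => i _.
  exact: meval_bracket.
elim: L LP => [|p L IH] LP.
  by exists [::]; split=> // x; rewrite /form_sum !big_nil meval0.
have [|M [MP ME]] := IH; first by move=> q qL; apply: LP; rewrite inE qL orbT.
have [c [P [Pk cE]]] := mono p.2 (LP p (mem_head _ _)).
exists ((p.1 * c, P) :: M); split; first by rewrite /= Pk eqxx.
move=> x; rewrite /form_sum !big_cons /= mevalD mevalZ cE mulrA; congr (_ + _).
exact: ME.
Qed.

Lemma homogeneous_invariant (H : poly2) k G : odd n -> H != 0 -> invariant_poly G ->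
  (forall x, H.@[x] != 0 -> G.@[scale (fun=> 2) x] = 2 ^+ (n * k).*2 * G.@[x]) ->
  exists M, all (fun p => size p.2 == k) M /\ forall x, G.@[x] = form_sum M (pluecker x).
Proof.
move=> n_odd H0 Ginv Ghd.
have Gh x : G.@[scale (fun=> 2) x] = 2 ^+ (n * k).*2 * G.@[x].
  pose lq : (n + n).-tuple poly2 := [tuple 2 *: 'X_k | k < n + n].
  have GE z : (G \mPo lq).@[z] = G.@[scale (fun=> 2) z].
    rewrite comp_mpoly_meval; apply: meval_eq => j.
    by rewrite tnth_mktuple mevalZ mevalXU.
  rewrite -GE -mevalZ; congr (_.@[x]); apply: (meval_dense H0) => z Hz.
  by rewrite GE mevalZ Ghd.
have [Gk _] := invariant_decomposition n_odd Ginv.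
apply: bracket_span_forms; suff <- : degree_part (n * k).*2 G = G by [].
apply/mpolyP => m; rewrite coef_degree_part; have [->|Gm] := eqVneq G@_m 0.
  by rewrite mul0rn.
have /eqP := @scaling_monomials F n (fun=> 2) _ G Gh m Gm.
by rewrite prodrXr -mdegE -!natrX eqr_nat eqn_exp2l // => ->.
Qed.

Lemma dense_invariant (H G : poly2) (U : point -> Prop) (f : point -> F) : H != 0 ->
  (forall x, H.@[x] != 0 -> U x) -> (forall x, U x -> f x = G.@[x]) ->
  (forall x t, U x -> U (shear x t) /\ f (shear x t) = f x) ->
  (forall x, U x -> U (scale squeeze x) /\ f (scale squeeze x) = f x) ->
  (forall i j x, i != j -> U x ->
     U (scale (coweight i j) x) /\ f (scale (coweight i j) x) = f x) ->
  invariant_poly G.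
Proof.
move=> H0 HU fG sh sq tor.
have dense (g : point -> point) (lq : (n + n).-tuple poly2) :
    (forall x k, (tnth lq k).@[x] = g x k) -> (forall x, U x -> U (g x) /\ f (g x) = f x) ->
    forall x, G.@[g x] = G.@[x].
  move=> lqE gU; have GE x : (G \mPo lq).@[x] = G.@[g x].
    by rewrite comp_mpoly_meval; apply: meval_eq => k; rewrite lqE.
  move=> x; rewrite -GE; congr (_.@[x]); apply: (meval_dense H0) => {}x /HU Ux.
  by have [Ugx fgx] := gU x Ux; rewrite GE -!fG.
have densel l : (forall x, U x -> U (scale l x) /\ f (scale l x) = f x) ->
    forall x, G.@[scale l x] = G.@[x].
  apply: (dense _ [tuple l k *: 'X_k | k < n + n]) => x k.
  by rewrite tnth_mktuple mevalZ mevalXU.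
split.
- move=> x t; have := dense (fun x => shear x t)
    [tuple if split k is inr i then 'X_k + t *: 'X_(lshift n i) else 'X_k | k < n + n].
  apply => {x} [x k|x Ux]; last exact: sh.
    rewrite tnth_mktuple /shear; case: split => i; first by rewrite mevalXU.
    by rewrite mevalD mevalZ !mevalXU.
- exact: densel.
- by move=> i j ij; apply: densel => x; exact: tor.
Qed.

End InvariantPolynomials.

(** * Columns in general position *)

Section GeneralPosition.
Variables (F : numClosedFieldType) (n : nat).
Local Notation poly2 := {mpoly F[n + n]}.
Local Notation point := ('I_(n + n) -> F).

Definition generic_poly : poly2 :=
  (\prod_i \prod_(j | j != i) bracket F i j) * \prod_k 'X_k.

Lemma bracket_neq0 (i j : 'I_n) : i != j -> bracket F i j != 0.
Proof.
move=> ij; pose x : point := fun k => ((k == lshift n i) || (k == rshift n j))%:R.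
apply/eqP => /(congr1 (meval x)); rewrite meval0 meval_bracket mxE /x.
rewrite !eqxx orbT /= eq_lrshift eq_rlshift !(inj_eq (@lshift_inj _ _)).
rewrite eq_sym (negPf ij) /= mul1r mul0r subr0 => /eqP.
by rewrite oner_eq0.
Qed.

Lemma generic_poly_neq0 : generic_poly != 0.
Proof.
rewrite mulf_neq0 //; last first.
  apply/prodf_neq0 => k _; apply/eqP => /(congr1 (mcoeff U_(k))).
  by rewrite mcoeffX eqxx mcoeff0 => /eqP; rewrite oner_eq0.
by apply/prodf_neq0 => i _; apply/prodf_neq0 => j; rewrite eq_sym; exact: bracket_neq0.
Qed.

Lemma generic_pointP (x : point) : generic_poly.@[x] != 0 ->
  (forall i j, i != j -> pluecker x i j != 0) /\ (forall k, x k != 0).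
Proof.
rewrite /generic_poly mevalM mulf_eq0 negb_or !rmorph_prod /= => /andP[/prodf_neq0 hb /prodf_neq0 hx].
split=> [i j ij|k]; last by have := hx k isT; rewrite mevalXU.
have := hb i isT; rewrite rmorph_prod => /prodf_neq0/(_ j).
by rewrite eq_sym -meval_bracket; exact.
Qed.

Lemma pluecker_upd (x : point) k t a b : a != column k -> b != column k ->
  pluecker (upd x k t) a b = pluecker x a b.
Proof.
move=> ak bk; rewrite !mxE /upd.
have ne c : c != column k -> (lshift n c == k) = false /\ (rshift n c == k) = false.
  rewrite /column; case: (split_ordP k) => i -> => ci.
    by rewrite (inj_eq (@lshift_inj _ _)) (negPf ci) eq_rlshift.
  by rewrite (inj_eq (@rshift_inj _ _)) (negPf ci) eq_lrshift.
by have [-> ->] := ne a ak; have [-> ->] := ne b bk.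
Qed.

Lemma pluecker_skew (x : point) a b : pluecker x b a = - pluecker x a b.
Proof. by rewrite !mxE; ring. Qed.

(** From u_i p_bb' = u_b p_ib' - u_b' p_ib, and the same with v in place of u. *)
Lemma parallel_unique (x : point) i b b' :
  (x (lshift n i) != 0) || (x (rshift n i) != 0) ->
  pluecker x i b = 0 -> pluecker x i b' = 0 -> pluecker x b b' = 0.
Proof.
rewrite !mxE => xi e e'.
case/orP: xi => xi; apply: (mulfI xi); rewrite mulr0.
  transitivity (x (lshift n b) * (x (lshift n i) * x (rshift n b') - x (lshift n b') * x (rshift n i))
     - x (lshift n b') * (x (lshift n i) * x (rshift n b) - x (lshift n b) * x (rshift n i))).
    by ring.
  by rewrite e e' !mulr0 subr0.
transitivity (x (rshift n b) * (x (lshift n i) * x (rshift n b') - x (lshift n b') * x (rshift n i))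
     - x (rshift n b') * (x (lshift n i) * x (rshift n b) - x (lshift n b) * x (rshift n i))).
  by ring.
by rewrite e e' !mulr0 subr0.
Qed.

End GeneralPosition.

(** The rotations by 1 and by 2 have no edge in common when n >= 4, even forgetting
    orientations, so one of them avoids the edge i - j. *)
Lemma rotation_avoiding n (i j : 'I_n) : (4 <= n)%N ->
  exists f : {perm 'I_n}, forall a,
    [/\ f a != a, ~~ ((a == i) && (f a == j)) & ~~ ((a == j) && (f a == i))].
Proof.
case: n i j => // n i j n4.
pose rot (s : nat) : {perm 'I_n.+1} := perm (addIr (inZp s : 'I_n.+1)).
have rotE s a : rot s a = a + inZp s by rewrite permE.
have ne0 s : (0 < s < 4)%N -> (inZp s : 'I_n.+1) != 0.
  move=> /andP[s0 s4]; rewrite -val_eqE /= modn_small ?(leq_trans s4) //.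
  by rewrite -lt0n.
have addZ s t : (inZp s + inZp t : 'I_n.+1) = inZp (s + t).
  by apply: val_inj; rewrite /= modnDm.
have fixfree s a : (0 < s < 4)%N -> rot s a != a.
  by move=> hs; rewrite rotE -subr_eq0 addrAC subrr add0r ne0.
have [/andP[j1 j2]|bad] := boolP ((j != i + inZp 1) && (i != j + inZp 1)).
  exists (rot 1) => a; split; first exact: fixfree.
    by apply/negP => /andP[/eqP -> /eqP e]; rewrite -e rotE eqxx in j1.
  by apply/negP => /andP[/eqP -> /eqP e]; rewrite -e rotE eqxx in j2.
exists (rot 2) => a; split; first exact: fixfree.
  (* an edge common to both rotations gives 1 = 2 or 1 + 2 = 0 modulo n *)
  apply/negP => /andP[/eqP -> /eqP e]; move: bad; rewrite -e !rotE negb_and !negbK.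
  case/orP.
    rewrite -subr_eq0 opprD addrACA subrr add0r subr_eq0 => /eqP e12.
    have := ne0 1 isT; rewrite -(addrK (inZp 1 : 'I_n.+1) (inZp 1)) addZ e12.
    by rewrite subrr eqxx.
  rewrite -addrA addZ eq_sym -subr_eq0 addrAC subrr add0r => e3.
  by have := ne0 3 isT; rewrite e3.
apply/negP => /andP[/eqP -> /eqP e]; move: bad; rewrite -e !rotE negb_and !negbK.
case/orP; last first.
  rewrite -subr_eq0 opprD addrACA subrr add0r subr_eq0 => /eqP e12.
  have := ne0 1 isT; rewrite -(addrK (inZp 1 : 'I_n.+1) (inZp 1)) addZ e12.
  by rewrite subrr eqxx.
rewrite -addrA addZ eq_sym -subr_eq0 addrAC subrr add0r => e3.
by have := ne0 3 isT; rewrite e3.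
Qed.

(** The moving column is parallel to at most one other column j; the rotation
    avoids the edge between them. *)
Lemma generic_line_form (F : numClosedFieldType) n (x : 'I_(n + n) -> F) k t :
  (4 <= n)%N -> (generic_poly F n).@[x] != 0 ->
  exists f : {perm 'I_n}, perm_form f (pluecker (upd x k t)) != 0.
Proof.
move=> n4 /generic_pointP[xb xk]; set y := upd x k t; set i := column k.
have yi : (y (lshift n i) != 0) || (y (rshift n i) != 0).
  rewrite /y /upd /i /column; case: (split_ordP k) => c ->.
    by rewrite [rshift n c == _]eq_rlshift xk orbT.
  by rewrite eq_lrshift xk.
have yb a b : a != i -> b != i -> a != b -> pluecker y a b != 0.
  by move=> ai bi ab; rewrite pluecker_upd // xb.
have [j jP] : exists j, forall b, b != i -> b != j -> pluecker y i b != 0.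
  have [/existsP[j /andP[ji /eqP j0]]|/existsPn no] :=
    boolP [exists j, (j != i) && (pluecker y i j == 0)]; last first.
    by exists i => b bi _; have := no b; rewrite negb_and bi.
  exists j => b bi bj; apply/eqP => b0.
  by have /eqP := parallel_unique yi j0 b0; apply/negP/yb; rewrite // eq_sym.
have [f fP] := rotation_avoiding i j n4; exists f; apply/prodf_neq0 => a _.
have [fa fij fji] := fP a.
have [ai|ai] := eqVneq a i.
  rewrite ai in fa fij *; apply: jP => //; move: fij; by rewrite eqxx.
have [fai|fai] := eqVneq (f a) i; last by apply: yb; rewrite // eq_sym.
rewrite fai pluecker_skew oppr_eq0; apply: jP => //.
by move: fji; rewrite fai eqxx andbT.
Qed.

(** * Sections on the cone *)

Section Sections.
Variables (R : realType) (n : nat).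
Local Notation C := R[i].
Local Notation poly2 := {mpoly C[n + n]}.
Local Notation point := ('I_(n + n) -> C).
Local Notation cone := (@grass_cone R n).

Lemma wedgeE (u v : 'rV[C]_n) i j : wedge u v i j = u 0 i * v 0 j - v 0 i * u 0 j.
Proof. by rewrite !mxE !big_ord1 !mxE. Qed.

Lemma wedge_rows (x : point) :
  wedge (\row_i x (lshift n i)) (\row_i x (rshift n i)) = pluecker x.
Proof. by apply/matrixP => i j; rewrite wedgeE !mxE; congr (_ - _); rewrite mulrC. Qed.

Lemma cone_pluecker (x : point) : pluecker x != 0 -> cone (pluecker x).
Proof.
move=> x0; split=> //; set u := \row_i x (lshift n i); set v := \row_i x (rshift n i).
have uv : wedge u v != 0 by rewrite wedge_rows.
have v0 : v != 0.
  by apply: contraNneq uv => ->; apply/eqP/matrixP => i j; rewrite wedgeE !mxE; ring.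
exists <<[:: u; v]>>%VS; split.
  apply/eqP; rewrite -[_ == _]/(free [:: u; v]) free_cons seq1_free v0 andbT span_seq1.
  apply: contraNN uv => /vlineP[k ->]; apply/eqP/matrixP => i j.
  by rewrite wedgeE !mxE; ring.
exists u, v; split; rewrite ?wedge_rows //; apply: memv_span; rewrite !inE eqxx ?orbT //.
Qed.

Lemma cone_coords (y : cone) : exists x, val y = pluecker x.
Proof.
have [_ [W [_ [u [v [_ _ ->]]]]]] := set_valP y.
exists (fun k => match fintype.split k with inl i => u 0 i | inr i => v 0 i end).
rewrite -wedge_rows; congr wedge; apply/rowP => i; rewrite mxE.
  by rewrite (unsplitK (inl i)).
by rewrite (unsplitK (inr i)).
Qed.

Lemma cone_neq0 (y : cone) : val y != 0.
Proof. by have [] := set_valP y. Qed.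

Lemma cone_point (x : point) : pluecker x != 0 -> exists y : cone, val y = pluecker x.
Proof. by move=> /cone_pluecker/mem_set h; exists (SigSub h). Qed.

Definition on_cone (f : cone -> C) (x : point) : C :=
  if pselect (exists y : cone, val y = pluecker x) is left h
  then f (projT1 (cid h)) else 0.

Lemma on_coneE (f : cone -> C) x (y : cone) : val y = pluecker x -> on_cone f x = f y.
Proof.
move=> yx; rewrite /on_cone; case: pselect => [h|[]]; last by exists y.
by congr f; apply: val_inj; rewrite yx; exact: projT2 (cid h).
Qed.

Lemma meval_mx_pluecker (P : {mpoly C[n * n]}) :
  exists G : poly2, forall x, G.@[x] = meval_mx P (pluecker x).
Proof.
pose B : 'M[poly2]_n := \matrix_(i, j) bracket C i j.
pose lq := [tuple mxvec B 0 k | k < n * n].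
exists (P \mPo lq) => x; rewrite comp_mpoly_meval /meval_mx; apply: meval_eq => k.
rewrite tnth_mktuple; case/mxvec_indexP: k => i j; rewrite !mxvecE.
by rewrite [B _ _]mxE meval_bracket.
Qed.

Local Notation generic := (generic_poly C n).

Lemma generic_line_cone (x : point) k t : (3 <= n)%N -> generic.@[x] != 0 ->
  pluecker (upd x k t) != 0.
Proof.
move=> n3 /generic_pointP[xb _].
have [a [b [ak bk ab]]] : exists a b : 'I_n, [/\ a != column k, b != column k & a != b].
  have : (1 < #|[set~ column k]|)%N by rewrite cardsC1 card_ord; case: (n) n3 => [|[|[]]].
  by move=> /card_gt1P[a [b [/[!inE] ak bk ab]]]; exists a, b.
apply/eqP => /matrixP/(_ a b); rewrite pluecker_upd // [RHS]mxE => /eqP.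
by rewrite (negPf (xb a b ab)).
Qed.

Lemma generic_cone (x : point) : (3 <= n)%N -> generic.@[x] != 0 -> pluecker x != 0.
Proof.
move=> n3 gx; have n0 : (0 < n)%N by exact: leq_trans n3.
have -> : x = upd x (lshift n (Ordinal n0)) (x (lshift n (Ordinal n0))).
  by apply/funext => j; rewrite /upd; case: eqP => [->|].
exact: generic_line_cone.
Qed.

Lemma section_polynomial d f : (3 <= n)%N -> grass_section d f ->
  exists G : poly2, forall x (y : cone), val y = pluecker x -> f y = G.@[x].
Proof.
move=> n3 df; have n0 : (0 < n)%N by exact: leq_trans n3.
have [G GE] : exists G : poly2, forall x, pluecker x != 0 -> on_cone f x = G.@[x].
  apply: (@hartogs _ _ (lshift n (Ordinal n0)) _ _ generic).
  - exact: generic_poly_neq0.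
  - by move=> x k t; exact: generic_line_cone.
  move=> z /cone_point[y yz]; have [k [P [Q [_ _ Qy fE]]]] := df y.
  have [a aE] := meval_mx_pluecker P; have [b bE] := meval_mx_pluecker Q.
  exists a, b; split=> [|x /cone_point[w wx]]; first by rewrite bE -yz.
  by rewrite bE aE -wx (on_coneE f wx); exact: fE.
exists G => x y yx; rewrite -GE -?yx ?cone_neq0 //; exact/esym/on_coneE.
Qed.

Lemma pluecker_shear (x : point) t : pluecker (shear x t) = pluecker x.
Proof.
apply/matrixP => i j; rewrite !mxE /shear !(unsplitK (inl _)) !(unsplitK (inr _)); ring.
Qed.

Lemma pluecker_squeeze (x : point) : pluecker (scale (@squeeze C n) x) = pluecker x.
Proof.
apply/matrixP => i j; rewrite !mxE /scale /squeeze.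
rewrite !(unsplitK (inl _)) !(unsplitK (inr _)).
have h : (2 : C) * 2^-1 = 1 by rewrite divff // pnatr_eq0.
by congr (_ - _); rewrite mulrACA h mul1r.
Qed.

Definition coweight_mx (i j : 'I_n) : 'M[C]_n :=
  diag_mx (\row_k weight C i j k).

Lemma torus_coweight i j : i != j -> torus (coweight_mx i j).
Proof.
move=> ij; split; first exact: diag_mx_is_diag.
have ji : j != i by rewrite eq_sym.
rewrite det_diag (bigD1 i) //= mxE /weight eqxx (bigD1 j) //= mxE (negPf ji) eqxx.
rewrite big1 ?mulr1 ?divff ?pnatr_eq0 // => k /andP[/negPf ki /negPf kj].
by rewrite mxE ki kj.
Qed.

Lemma diag_conj (d : 'rV[C]_n) (w : 'M[C]_n) i j :
  ((diag_mx d)^T *m w *m diag_mx d) i j = d 0 i * d 0 j * w i j.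
Proof. by rewrite tr_diag_mx mul_diag_mx mul_mx_diag !mxE; ring. Qed.

Lemma pluecker_coweight i j (x : point) : pluecker (scale (coweight C i j) x) =
  (coweight_mx i j)^T *m pluecker x *m coweight_mx i j.
Proof.
apply/matrixP => k l; rewrite diag_conj !mxE /scale /coweight /column.
rewrite !(unsplitK (inl _)) !(unsplitK (inr _)); ring.
Qed.

Lemma pluecker_scale2 (x : point) : pluecker (scale (fun=> 2) x) = 4 *: pluecker x.
Proof. by apply/matrixP => i j; rewrite !mxE /scale; ring. Qed.

(** A polynomial that restricts to a T-invariant function on a T-stable dense part
    S of the cone is invariant; SL_2 acts trivially on the minors. *)
Lemma torus_polynomial (S : cone -> Prop) (f : cone -> C) (G : poly2) (H : poly2) :
  H != 0 ->
  (forall t, torus t -> forall x y : cone, val y = t^T *m val x *m t -> S x ->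
     S y /\ f y = f x) ->
  (forall x, H.@[x] != 0 -> exists2 y : cone, val y = pluecker x & S y) ->
  (forall x (y : cone), val y = pluecker x -> S y -> f y = G.@[x]) ->
  invariant_poly G.
Proof.
move=> H0 Tf HS fG.
apply: (@dense_invariant _ _ H G (fun x => exists2 y : cone, val y = pluecker x & S y) (on_cone f)).
- exact: H0.
- exact: HS.
- by move=> x [y yx Sy]; rewrite (on_coneE f yx); exact: fG.
- move=> x t [y yx Sy]; split; first by exists y; rewrite ?pluecker_shear.
  by rewrite (on_coneE f yx); apply: on_coneE; rewrite pluecker_shear.
- move=> x [y yx Sy]; split; first by exists y; rewrite ?pluecker_squeeze.
  by rewrite (on_coneE f yx); apply: on_coneE; rewrite pluecker_squeeze.
move=> i j x ij [y yx Sy].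
have [z zx] : exists z : cone, val z = pluecker (scale (coweight C i j) x).
  apply: cone_point; apply: contraNneq (cone_neq0 y) => e0; rewrite yx.
  apply/eqP/matrixP => k l; have /matrixP/(_ k l) := e0.
  rewrite pluecker_coweight diag_conj !mxE => /eqP.
  have wn0 c : weight C i j c != 0.
    by rewrite /weight; do 2?case: ifP => _; rewrite ?invr_eq0 ?pnatr_eq0 ?oner_eq0.
  by rewrite !mulf_eq0 !(negPf (wn0 _)) => /eqP.
have zy : val z = (coweight_mx i j)^T *m val y *m coweight_mx i j.
  by rewrite zx pluecker_coweight yx.
have [Sz fzy] := Tf _ (torus_coweight ij) _ _ zy Sy.
by rewrite (on_coneE f yx) (on_coneE f zx); split=> //; exists z.
Qed.

Local Notation A := (invariant_sections R n).

Lemma invariant_section_forms m f : (3 <= n)%N -> odd n -> A m f ->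
  exists M, all (fun p => size p.2 == m) M /\ forall y : cone, f y = form_sum M (val y).
Proof.
move=> n3 n_odd [df Tf]; have [G GE] := section_polynomial n3 df.
have Ginv : invariant_poly G.
  apply: (@torus_polynomial (fun=> True) f G generic (generic_poly_neq0 C n)) => //.
  - by move=> t Tt x y xy _; split=> //; exact: Tf xy.
  - by move=> x /(generic_cone n3)/cone_point[y yx]; exists y.
  - by move=> x y yx _; exact: GE.
have [|M [Mm ME]] := homogeneous_invariant (k := m) n_odd (generic_poly_neq0 C n) Ginv.
  move=> x /(generic_cone n3)/cone_point[y yx].
  have [z zx] : exists z : cone, val z = pluecker (scale (fun=> 2) x).
    apply: cone_point; rewrite pluecker_scale2 -yx scaler_eq0 negb_or cone_neq0 andbT.
    by rewrite pnatr_eq0.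
  rewrite -(GE _ _ zx) -(GE _ _ yx).
  rewrite (grass_sectionZ (c := 4) (x := y) df) ?pnatr_eq0 //; last first.
    by rewrite zx pluecker_scale2 yx.
  have -> : 4 = 2 ^+ 2 :> C by ring.
  by rewrite -exprM mul2n.
exists M; split=> // y; have [x yx] := cone_coords y.
by rewrite (GE _ _ yx) ME yx.
Qed.

Lemma perm_form_section (f : {perm 'I_n}) : A 1%N (fun y => perm_form f (val y)).
Proof.
split=> [x|t [/is_diag_mxP tdiag tdet] x y ->].
  exists 0%N, (\prod_i 'X_(mxvec_index i (f i))), 1; rewrite addn0 muln1; split.
  - have -> : \prod_i 'X_(mxvec_index i (f i)) =
        'X_[\sum_i U_(mxvec_index i (f i))] :> {mpoly C[n * n]} by exact: mprodXE.
    rewrite dhomogX /= mdeg_sum; under eq_bigr do rewrite mdeg1.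
    by rewrite sum1_card card_ord.
  - exact: dhomog1.
  - by rewrite /meval_mx meval1 oner_eq0.
  move=> y _; rewrite /meval_mx meval1 divr1 rmorph_prod /=; apply: eq_bigr => i _.
  by rewrite mevalXU mxvecE.
pose d : 'rV[C]_n := \row_i t i i.
have td : t = diag_mx d.
  apply/matrixP => i j; rewrite !mxE; have [->|ij] := eqVneq i j; first by rewrite mulr1n.
  by rewrite mulr0n tdiag.
have dd : \prod_i d 0 i = 1 by rewrite -det_diag -td.
have conj i j : (t^T *m val x *m t) i j = d 0 i * d 0 j * val x i j.
  by rewrite td diag_conj.
rewrite /perm_form (eq_bigr _ (fun i _ => conj i (f i))).
rewrite !big_split /= dd mul1r; suff -> : \prod_i d 0 (f i) = 1 by rewrite mul1r.
by rewrite -[RHS]dd [RHS](reindex_inj (@perm_inj _ f)) /=.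
Qed.

End Sections.

(** * The case of three columns *)

Section ThreeColumns.
Variable F : numClosedFieldType.

Definition cycle3 : {perm 'I_3} := perm (addIr (1 : 'I_3)).

(** A permutation of three elements has a fixed point, where the form vanishes, or
    is one of the two cycles, whose forms are opposite. *)
Lemma perm_form3 (f : {perm 'I_3}) :
  exists e : F, forall x, perm_form f (pluecker x) = e * perm_form cycle3 (pluecker x).
Proof.
have formE (g : {perm 'I_3}) (w : 'M[F]_3) :
    perm_form g w = w 0 (g 0) * (w 1 (g 1) * w (2%:R : 'I_3) (g (2%:R : 'I_3))).
  rewrite /perm_form !big_ord_recl big_ord0 mulr1.
  by do 2!(congr (_ * _)); congr (w _ (g _)); apply: val_inj.
have ord3 (k : 'I_3) : [\/ k = 0, k = 1 | k = 2%:R].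
  by case: k => [[|[|[|k]]] hk] //; [apply: Or31|apply: Or32|apply: Or33]; apply: val_inj.
have cE : [/\ cycle3 0 = 1, cycle3 1 = 2%:R & cycle3 2%:R = 0].
  by rewrite !permE; split; apply: val_inj.
have diag0 (x : 'I_(3 + 3) -> F) i : pluecker x i i = 0 by rewrite mxE; ring.
have skew (x : 'I_(3 + 3) -> F) i j := pluecker_skew x i j.
have inj := @perm_inj _ f.
case: (ord3 (f 0)) => f0; [by exists 0 => x; rewrite formE f0 diag0; ring| |];
  case: (ord3 (f 1)) => f1;
  try (by exists 0 => x; rewrite formE f1 diag0; ring);
  try (by have := inj _ _ (etrans f0 (esym f1)));
  case: (ord3 (f 2%:R)) => f2;
  try (by exists 0 => x; rewrite formE f2 diag0; ring);
  try (by have := inj _ _ (etrans f0 (esym f2)));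
  try (by have := inj _ _ (etrans f1 (esym f2))).
- by exists 1 => x; rewrite !formE f0 f1 f2; case: cE => -> -> ->; ring.
- exists (-1) => x; rewrite !formE f0 f1 f2; case: cE => -> -> ->.
  by rewrite (skew x 0 1) (skew x 1 2%:R) (skew x 2%:R 0); ring.
Qed.
End ThreeColumns.

(** * Sections on the quotient *)

Section Quotient.
Variables (R : realType) (n : nat).
Local Notation C := R[i].
Local Notation poly2 := {mpoly C[n + n]}.
Local Notation point := ('I_(n + n) -> C).
Local Notation cone := (@grass_cone R n).
Local Notation A := (invariant_sections R n).
Local Notation Psec := (@Proj_section R _ A).
Local Notation locus := (nonvanishing_locus A).
Local Notation generic := (generic_poly C n).
Local Notation sized m := (all (fun p : C * seq {perm 'I_n} => size p.2 == m)).

Lemma form_sum_section m M : sized m M -> A m (fun y => form_sum M (val y)).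
Proof.
have prodA (L : seq {perm 'I_n}) :
    A (size L) (fun y => \prod_(f <- L) perm_form f (val y)).
  elim: L => [|f L IH].
    suff -> : (fun y : cone => \prod_(f <- [::]) perm_form f (val y)) = cst 1.
      exact: (piece_cst A).
    by apply/funext => y; rewrite big_nil.
  suff -> : (fun y : cone => \prod_(g <- f :: L) perm_form g (val y)) =
     (fun y : cone => perm_form f (val y)) * (fun y => \prod_(g <- L) perm_form g (val y)).
    exact: (@pieceM _ _ A 1%N (size L) _ _ (perm_form_section R f) IH).
  by apply/funext => y; rewrite big_cons.
elim: M => [_|p M IH /= /andP[/eqP pm MA]].
  suff -> : (fun y : cone => form_sum [::] (val y)) = 0 by exact: (piece_zero A).
  by apply/funext => y; rewrite /form_sum big_nil.
suff -> : (fun y : cone => form_sum (p :: M) (val y)) =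
   cst p.1 * (fun y : cone => \prod_(f <- p.2) perm_form f (val y)) +
   (fun y : cone => form_sum M (val y)).
  have pA := @pieceM _ _ A 0%N _ _ _ (piece_cst A p.1) (prodA p.2).
  by rewrite pm in pA; exact: (@pieceD _ _ A m _ _ pA (IH MA)).
by apply/funext => y; rewrite /form_sum big_cons.
Qed.

Lemma form_sum_Proj m M : sized m M ->
  Psec m (fun y => form_sum M (val (val y))).
Proof.
move=> MA y; exists 0%N, (fun z => form_sum M (val z)), (cst 1); split.
- by rewrite addn0; exact: form_sum_section.
- exact: (piece_cst A).
- exact: oner_neq0.
- by move=> z _; rewrite divr1.
Qed.

Lemma locus_torus t (x y : cone) : torus t -> val y = t^T *m val x *m t ->
  locus x -> locus y.
Proof.
move=> Tt xy [m [f [m0 Af fx]]]; exists m, f; split=> //.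
by have [_ Tf] := Af; rewrite (Tf t Tt x y xy).
Qed.

Definition by_zero (s : locus -> C) (y : cone) : C :=
  if pselect (locus y) is left h then s (SigSub (classical_sets.mem_set h)) else 0.

Lemma by_zeroE s (z : locus) : by_zero s (val z) = s z.
Proof.
rewrite /by_zero; case: pselect => [h|[]]; last exact: set_valP.
by congr s; apply: val_inj.
Qed.

Lemma locus_ex (y : cone) : locus y -> exists z : locus, val z = y.
Proof. by move=> /classical_sets.mem_set h; exists (SigSub h). Qed.

Lemma Proj_torus m s t (x y : locus) : Psec m s -> torus t ->
  val (val y) = t^T *m val (val x) *m t -> s y = s x.
Proof.
move=> Ps Tt xy; have [k [a [b [[_ Ta] [_ Tb] bx sE]]]] := Ps x.
have ay := Ta t Tt _ _ xy; have by_ := Tb t Tt _ _ xy.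
by rewrite (sE x bx) (sE y) ?by_ ?ay.
Qed.

Lemma generic_line_locus (x : point) k t : (4 <= n)%N -> generic.@[x] != 0 ->
  exists2 y : cone, val y = pluecker (upd x k t) & locus y.
Proof.
move=> n4 gx; have [f fx] := generic_line_form k t n4 gx.
have [y yx] : exists y : cone, val y = pluecker (upd x k t).
  by apply: cone_point; apply: generic_line_cone => //; exact: leq_trans n4.
exists y => //; exists 1%N, (fun y => perm_form f (val y)); split=> //.
  exact: perm_form_section.
by rewrite yx.
Qed.

Lemma generic_locus (x : point) : (3 <= n)%N -> generic.@[x] != 0 ->
  exists2 y : cone, val y = pluecker x & locus y.
Proof.
case: n x => // n' x n3 gx; have [y yx] := cone_point (generic_cone n3 gx).
exists y => //; pose f : {perm 'I_n'.+1} := perm (addIr (inZp 1 : 'I_n'.+1)).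
exists 1%N, (fun y => perm_form f (val y)); split=> //; first exact: perm_form_section.
rewrite yx; apply/prodf_neq0 => i _; have [xb _] := generic_pointP gx; apply: xb.
rewrite permE eq_sym -subr_eq0 addrAC subrr add0r -val_eqE /=.
by rewrite modn_small // ltnW.
Qed.

(** [hartogs] applies because a line through a general point stays in the semistable
    locus; the degree is read off from the scaling by 2 of the two rows. *)
Lemma Proj_section_forms_ge4 m s : (4 <= n)%N -> odd n -> Psec m s ->
  exists M, sized m M /\ forall y : locus, s y = form_sum M (val (val y)).
Proof.
move=> n4 n_odd Ps; have n3 : (3 <= n)%N by exact: leq_trans n4.
have n0 : (0 < n)%N by exact: leq_trans n4.
pose f := by_zero s.
have onE x (z : locus) : val (val z) = pluecker x -> on_cone f x = s z.
  by move=> zx; rewrite (on_coneE f zx) /f by_zeroE.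
have [G GE] : exists G : poly2, forall x,
    (exists2 y : cone, val y = pluecker x & locus y) -> on_cone f x = G.@[x].
  apply: (@hartogs _ _ (lshift n (Ordinal n0)) _ _ generic).
  - exact: generic_poly_neq0.
  - by move=> x k t; exact: generic_line_locus.
  move=> z [y0 yz /locus_ex[y yE]]; rewrite -yE in yz.
  have [k [a [b [Aa Ab b_y sE]]]] := Ps y.
  have [a' aE] := section_polynomial n3 Aa.1; have [b' bE] := section_polynomial n3 Ab.1.
  exists a', b'; split=> [|x [w0 wx /locus_ex[w wE]]]; first by rewrite -(bE _ _ yz).
  rewrite -wE in wx; rewrite -(bE _ _ wx) -(aE _ _ wx) (onE _ _ wx); exact: sE.
have GE' x (z : locus) : val (val z) = pluecker x -> s z = G.@[x].
  move=> zx; rewrite -(onE _ _ zx); apply: GE; exists (val z) => //; exact: set_valP.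
have Ginv : invariant_poly G.
  apply: (@torus_polynomial _ _ locus f G generic (generic_poly_neq0 C n)).
  - move=> t Tt x y xy Lx; have Ly := locus_torus Tt xy Lx; split=> //.
    have [x' x'E] := locus_ex Lx; have [y' y'E] := locus_ex Ly.
    by rewrite /f -x'E -y'E !by_zeroE; apply: (Proj_torus Ps Tt); rewrite x'E y'E.
  - by move=> x; exact: generic_locus.
  - by move=> x y yx Ly; rewrite -GE; [exact/esym/on_coneE|exists y].
have [|M [Mm ME]] := homogeneous_invariant (k := m) n_odd (generic_poly_neq0 C n) Ginv.
  move=> x /(generic_locus n3)[y0 yx Ly]; have [y yE] := locus_ex Ly; rewrite -yE in yx.
  have [k [a [b [Aa Ab b_y sE]]]] := Ps y.
  have c0 : 4 != 0 :> C by rewrite pnatr_eq0.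
  have [z0 zx] : exists z : cone, val z = pluecker (scale (fun=> 2) x).
    apply: cone_point; rewrite pluecker_scale2 -yx scaler_eq0 negb_or cone_neq0 andbT.
    exact: c0.
  have zy : val z0 = 4 *: val (val y) by rewrite zx pluecker_scale2 yx.
  have [l [g [l0 Ag gy]]] := set_valP y.
  have Lz : locus z0.
    exists l, g; split=> //.
    by rewrite (grass_sectionZ Ag.1 c0 zy) mulf_neq0 // expf_neq0.
  have [z zE] := locus_ex Lz; rewrite -zE in zx zy.
  rewrite -(GE' _ _ zx) -(GE' _ _ yx).
  have bz := grass_sectionZ Ab.1 c0 zy; have az := grass_sectionZ Aa.1 c0 zy.
  rewrite (sE y b_y) sE ?bz ?mulf_neq0 ?expf_neq0 // az.
  rewrite mulnDr exprD -!mulrA; have -> : (2 : C) ^+ (n * m).*2 = 4 ^+ (n * m).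
    by have -> : 4 = 2 ^+ 2 :> C by [ring]; rewrite -exprM mul2n.
  congr (_ * _); rewrite mulrA -mulf_div divff ?mul1r // expf_neq0 //.
exists M; split=> // z; have [x zx] := cone_coords (val z).
by rewrite (GE' _ _ zx) ME zx.
Qed.

Lemma form_sum_map (g : cone -> C) M (e : {perm 'I_n} -> C) m : sized m M ->
  (forall f (y : cone), perm_form f (val y) = e f * g y) ->
  exists c, forall y, form_sum M (val y) = c * g y ^+ m.
Proof.
move=> Mm eE; exists (\sum_(p <- M) p.1 * \prod_(f <- p.2) e f) => y.
rewrite /form_sum mulr_suml big_seq [RHS]big_seq; apply: eq_bigr => p /(allP Mm)/eqP <-.
under eq_bigr do rewrite eE.
by rewrite big_split /= big_const_seq count_predT iter_mulr_1 mulrA.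
Qed.

(** All invariants of degree k are multiples of g ^+ k for a single form g, which
    vanishes nowhere on the semistable locus, so the quotient a / b that
    represents a section at one point represents it everywhere. *)
Lemma Proj_section_forms_eq3 m s : n = 3%N -> Psec m s ->
  exists M, sized m M /\ forall y : locus, s y = form_sum M (val (val y)).
Proof.
move=> n3 Ps; have n_odd : odd n by rewrite n3.
have n3' : (3 <= n)%N by rewrite n3.
have [c /choice[e eE]] : exists c : {perm 'I_n}, forall f, exists e : C, forall x,
    perm_form f (pluecker x) = e * perm_form c (pluecker x).
  by move: (n) n3 => _ ->; exists cycle3 => f; exact: perm_form3.
pose g (y : cone) := perm_form c (val y).
have ecE f (y : cone) : perm_form f (val y) = e f * g y.
  by rewrite /g; have [x ->] := cone_coords y; exact: eE.
have AE k f : A k f -> exists d, forall y, f y = d * g y ^+ k.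
  move=> /(invariant_section_forms n3' n_odd)[M [Mk fM]].
  have [d dE] := form_sum_map Mk ecE; by exists d => y; rewrite fM.
have g0 (y : locus) : g (val y) != 0.
  have [k [f [k0 /AE[d ->]]]] := set_valP y; rewrite mulf_eq0 negb_or => /andP[_].
  by rewrite expf_eq0 k0.
have [[y0 _]|no] := pselect (exists y : locus, True); last first.
  by exists [::]; split=> // y; case: no; exists y.
have [k [a [b [/AE[da aE] /AE[db bE] by0 sE]]]] := Ps y0.
have db0 : db != 0 by move: by0; rewrite bE mulf_eq0 negb_or => /andP[].
exists [:: (da / db, nseq m c)]; split; first by rewrite /= size_nseq eqxx.
move=> y; rewrite sE ?bE ?mulf_neq0 ?expf_neq0 // aE exprD.
rewrite /form_sum big_seq1 /= big_nseq iter_mulr_1 -/(g _).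
have gk : g (val y) ^+ k != 0 by rewrite expf_neq0.
by field; rewrite db0 gk.
Qed.

Lemma Proj_section_forms m s : (3 <= n)%N -> odd n -> Psec m s ->
  exists M, sized m M /\ forall y : locus, s y = form_sum M (val (val y)).
Proof.
move=> n3 n_odd; have [n4|n4] := leqP 4 n; first exact: Proj_section_forms_ge4.
by apply: Proj_section_forms_eq3; move: n3 n4 n_odd; case: (n) => [|[|[|[|]]]].
Qed.

Local Notation Q := (git_quotient_sections R n).

Lemma quotient_generated : (3 <= n)%N -> odd n -> generated_in_degree_one Q.
Proof.
move=> n3 n_odd B Bc BB BM B1 f /asboolP[N [s [Qs ->]]].
have B0 : B 0 by exact: Bc.
have BD g h : B g -> B h -> B (g + h).
  by move=> Bg Bh; rewrite -[h]opprK; apply: (BB) => //; rewrite -sub0r; exact: BB.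
elim/big_ind: _ => // k _; have [M [_ ME]] := Proj_section_forms n3 n_odd (Qs k).
have -> : s k = \sum_(p <- M) cst p.1 *
    \prod_(h <- p.2) (fun y : locus => perm_form h (val (val y))).
  apply/funext => y; rewrite ME fct_sumE; apply: eq_bigr => p _.
  by rewrite -[RHS]/(p.1 * _) fct_prodE.
elim/big_ind: _ => // p _; apply: (BM) => //.
elim/big_ind: _ => // [|h _]; first exact: (Bc 1).
apply: B1; move: (@form_sum_Proj 1 [:: (1, [:: h])] isT).
congr (Psec _ _); apply/funext => y.
by rewrite /form_sum !big_seq1 mul1r.
Qed.

Definition represents (a : locus -> C) (G : poly2) :=
  forall x (z : locus), val (val z) = pluecker x -> a z = G.@[x].

Lemma generic_point_locus (x : point) : (3 <= n)%N -> generic.@[x] != 0 ->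
  exists z : locus, val (val z) = pluecker x.
Proof.
by move=> n3 /(generic_locus n3)[y yx /locus_ex[z zE]]; exists z; rewrite zE.
Qed.

Lemma form_sum_poly M : exists G : poly2, forall x, G.@[x] = form_sum M (pluecker x).
Proof.
exists (\sum_(p <- M) p.1 *: \prod_(f <- p.2) \prod_i bracket C i ((f : {perm 'I_n}) i)) => x.
rewrite rmorph_sum; apply: eq_bigr => p _ /=; rewrite mevalZ rmorph_prod; congr (_ * _).
apply: eq_bigr => f _ /=; rewrite rmorph_prod; apply: eq_bigr => i _ /=.
exact: meval_bracket.
Qed.

Lemma direct_sum_polynomial a : (3 <= n)%N -> odd n -> a \in direct_sum Q ->
  exists G, invariant_poly G /\ represents a G.
Proof.
move=> n3 n_odd /asboolP[N [s [Qs ->]]].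
have [G GE] : exists G, represents (\sum_(k < N) s k) G.
  elim: N => [|N [G GE]]; first by exists 0 => x z _; rewrite big_ord0 meval0.
  have [M [_ ME]] := Proj_section_forms n3 n_odd (Qs N).
  have [H HE] := form_sum_poly M; exists (G + H) => x z zx.
  by rewrite big_ord_recr mevalD HE -zx -ME -(GE x z zx).
exists G; split=> //.
apply: (@torus_polynomial _ _ locus (by_zero (\sum_(k < N) s k)) G generic
  (generic_poly_neq0 C n)).
- move=> t Tt x y xy Lx; have Ly := locus_torus Tt xy Lx; split=> //.
  have [x' x'E] := locus_ex Lx; have [y' y'E] := locus_ex Ly.
  rewrite -x'E -y'E !by_zeroE !fct_sumE; apply: eq_bigr => k _.
  by apply: (Proj_torus (Qs k) Tt); rewrite x'E y'E.
- by move=> x; exact: generic_locus.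
- by move=> x y yx /locus_ex[z zE]; rewrite -zE in yx *; rewrite by_zeroE; exact: GE.
Qed.

(** Converse of the previous lemma: the invariant polynomials are exactly the
    elements of the ring of sections. *)
Lemma polynomial_direct_sum G : odd n -> invariant_poly G ->
  exists2 a, a \in direct_sum Q & represents a G.
Proof.
move=> n_odd /(invariant_decomposition n_odd)[Gk GE].
have /choice[M ME] k := bracket_span_forms (Gk k).
pose s k (y : locus) := form_sum (M k) (val (val y)).
exists (\sum_(k < msize G) s k).
  apply/asboolP; exists (msize G), s; split=> // k.
  by apply: form_sum_Proj; have [] := ME k.
move=> x z zx; rewrite fct_sumE [in RHS]GE rmorph_sum; apply: eq_bigr => k _ /=.
by have [_ ->] := ME k; rewrite /s zx.
Qed.

(** Computed in the ring of invariant polynomials. *)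
Lemma quotient_normal : (3 <= n)%N -> odd n -> normal_domain (gradedRing Q).
Proof.
move=> n3 n_odd.
pose ev (z : locus) (a : gradedRing Q) : C := gradedRing_val a z.
have evM z : {morph ev z : a b / a * b} by [].
have ev1 z : ev z 1 = 1 by [].
have evX z k : {morph ev z : a / a ^+ k}.
  by move=> a; elim: k => // k IH; rewrite !exprS evM IH.
have evD z : {morph ev z : a b / a + b} by [].
have rep (a : gradedRing Q) : exists G, invariant_poly G /\ represents (gradedRing_val a) G.
  by case: a => v hv; exact: (direct_sum_polynomial n3 n_odd hv).
have evE (a : gradedRing Q) G z x : represents (gradedRing_val a) G -> val (val z) = pluecker x ->
    G.@[x] = ev z a by move=> aG zx; rewrite -(aG x z zx).
have val_eq (a b : gradedRing Q) : (forall z, ev z a = ev z b) -> a = b.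
  by move=> ab; apply: val_inj; apply/funext.
have rep0 (a : gradedRing Q) : represents (gradedRing_val a) 0 -> a = 0.
  move=> a0; apply: val_eq => z; have [x zx] := cone_coords (val z).
  by rewrite -(evE _ _ _ _ a0 zx) meval0.
have poly_eq (P P' : poly2) :
    (forall x (z : locus), val (val z) = pluecker x -> P.@[x] = P'.@[x]) -> P = P'.
  move=> PP; apply: (meval_dense (generic_poly_neq0 C n)) => x.
  by move=> /(generic_point_locus n3)[z zx]; exact: PP zx.
split.
- have [x /(generic_point_locus n3)[z _]] := meval_neq0 (generic_poly_neq0 C n).
  by move=> /(congr1 (ev z))/eqP; rewrite oner_eq0.
- move=> a b ab; have [G [_ aG]] := rep a; have [H [_ bH]] := rep b.
  have /eqP : G * H = 0.
    apply: poly_eq => x z zx; rewrite mevalM meval0 (evE _ _ _ _ aG zx) (evE _ _ _ _ bH zx).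
    by rewrite -evM ab.
  by rewrite mulf_eq0 => /orP[]/eqP e; [left|right]; apply: rep0; rewrite -e.
move=> K phi phi_inj frac x N c xN.
have [a [b [b0 xE]]] := frac x.
have phib : phi b != 0.
  by apply/eqP => pb; apply: b0; apply: phi_inj; rewrite pb rmorph0.
(* the integral equation of x = phi a / phi b, cleared of denominators *)
have e : a ^+ N + \sum_(i < N) c i * a ^+ i * b ^+ (N - i) = 0.
  apply: phi_inj; rewrite rmorph0 rmorphD rmorph_sum rmorphXn /=.
  transitivity (phi b ^+ N * (x ^+ N + \sum_(i < N) phi (c i) * x ^+ i)); last by rewrite xN mulr0.
  have ax : phi a = x * phi b by rewrite xE divfK.
  rewrite mulrDr mulr_sumr ax exprMn mulrC; congr (_ + _); apply: eq_bigr => i _.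
  have -> : phi b ^+ N = phi b ^+ i * phi b ^+ (N - i) by rewrite -exprD subnKC // ltnW.
  by rewrite !rmorphM !rmorphXn /= ax exprMn; ring.
have [G [Ginv aG]] := rep a; have [H [Hinv bH]] := rep b.
have H0 : H != 0 by apply/eqP => H0; apply: b0; apply: rep0; rewrite -H0.
have /choice[D DE] i : exists D, represents (gradedRing_val (c i)) D.
  by have [D []] := rep (c i); exists D.
have [|S GHS] := @mdvd_integral _ _ N G H D H0.
  apply: poly_eq => y z zy; rewrite meval0 mevalD rmorph_sum rmorphXn /= (evE _ _ _ _ aG zy).
  rewrite -[RHS]/(ev z 0) -e evD evX; congr (_ + _).
  rewrite (big_morph (ev z) (evD z) (erefl (ev z 0))); apply: eq_bigr => i _.
  rewrite !evM !evX !mevalM !rmorphXn /= (evE _ _ _ _ aG zy) (evE _ _ _ _ bH zy).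
  by rewrite (evE _ _ _ _ (DE i) zy).
have Sinv : invariant_poly S.
  have SE g : (forall y, G.@[g y] = G.@[y]) -> (forall y, H.@[g y] = H.@[y]) ->
      forall y, H.@[y] != 0 -> H.@[g y] != 0 /\ S.@[g y] = S.@[y].
    move=> Gg Hg y Hy; rewrite Hg; split=> //; apply: (mulfI Hy).
    by rewrite -{1}Hg -!mevalM -GHS.
  case: Ginv Hinv => [G1 G2 G3] [H1 H2 H3].
  apply: (@dense_invariant _ _ H S (fun y => H.@[y] != 0) (fun y => S.@[y]) H0).
  - by move=> y.
  - by move=> y _.
  - by move=> y t; apply: (SE (fun y => shear y t)).
  - by move=> y; exact: (SE (fun y => scale (@squeeze C n) y)).
  - by move=> i j y ij; apply: (SE (fun y => scale (coweight C i j) y)) => z; [exact: G3|exact: H3].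
have [d dQ dS] := polynomial_direct_sum n_odd Sinv.
exists (GradedRing dQ); rewrite xE; apply: (canLR (mulfK phib)).
rewrite -rmorphM; congr (phi _); apply: val_eq => z; have [y zy] := cone_coords (val z).
rewrite evM -(evE _ _ _ _ aG zy) -(evE _ _ _ _ bH zy) GHS mevalM mulrC; congr (_ * _).
exact/esym/(dS y z zy).
Qed.

End Quotient.

Theorem theorem6p11 (R : realType) (n : nat) (n_ge3 : (3 <= n)%N) (n_odd : odd n) :
  projectively_normal (git_quotient_sections R n).
Proof. by split; [exact: quotient_normal|exact: quotient_generated]. Qed.
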